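(* Let $G=\langle h_1,\ldots,h_m\rangle$ be a finitely generated polynomial semigroup in $\mathcal{G}$. For each $j=1,\ldots,m$, let $a_j$ be the coefficient of the highest degree term of the polynomial $h_j$. Let $\alpha:=\min_{j=1,\ldots,m}\left\{\frac{-1}{\deg(h_j)-1}\log|a_j|\right\}$ and $\beta:=\max_{j=1,\ldots,m}\left\{\frac{-1}{\deg(h_j)-1}\log|a_j|\right\}$, and set $[\alpha,\beta]:=\{x\in\mathbb{R}\mid\alpha\leq x\leq\beta\}$. If $[\alpha,\beta]\subset\bigcup_{j=1}^{m}\Psi(h_j)^{-1}([\alpha,\beta])$, then $J(G)$ is connected.
   Context: $\hat{\mathbb{C}}$ is the Riemann sphere. A polynomial semigroup is a semigroup, under composition, generated by a non-empty family of non-constant polynomial maps $\hat{\mathbb{C}}\to\hat{\mathbb{C}}$; $\langle h_1,\ldots,h_m\rangle$ is the semigroup generated by $h_1,\ldots,h_m$. The Fatou set $F(G)$ is the set of $z\in\hat{\mathbb{C}}$ having a neighborhood on which $G$ is a normal family; the Julia set is $J(G)=\hat{\mathbb{C}}\setminus F(G)$. $CV(g)$ is the set of critical values of $g:\hat{\mathbb{C}}\to\hat{\mathbb{C}}$, $P(G)=\overline{\bigcup_{g\in G}CV(g)}$ (closure in $\hat{\mathbb{C}}$), and $P^{\ast}(G)=P(G)\setminus\{\infty\}$. $\mathcal{G}$ is the set of all polynomial semigroups $G$ such that each element of $G$ has degree at least two and $P^{\ast}(G)$ is bounded in $\mathbb{C}$. For a polynomial $g$ with leading coefficient $a(g)$,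 $\Psi(g):\mathbb{R}\to\mathbb{R}$ is the affine map $\Psi(g)(x)=\deg(g)\,x+\log|a(g)|$. *)

(* Defs.v *)
From HB Require Import structures.
From mathcomp Require Import all_boot all_order all_algebra.
From mathcomp Require Import complex.
From mathcomp Require Import all_classical all_reals all_analysis.

Set Implicit Arguments.
Unset Strict Implicit.
Unset Printing Implicit Defensive.
Import Order.TTheory GRing.Theory Num.Theory.
Import numFieldNormedType.Exports.
Local Open Scope classical_set_scope.
Local Open Scope ring_scope.

(* The topological and normed structures live on the regular module R[i]^o;
   its norm takes values in R[i], while [Normc.normc] is the real modulus. *)
Notation cplx R := (R[i]^o)%type (only parsing).
Notation modulus := Normc.normc.

(* [Some z] is the finite point z, [None] is the point at infinity. *)
Notation sphere R := (one_point_compactification (R[i]^o)%type).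

Definition infty {R : realType} : sphere R := None.
Definition finite_pt {R : realType} (z : cplx R) : sphere R := Some z.

(* Chordal distance; it induces the topology of [sphere R]. *)
Definition chordal (R : realType) (x y : sphere R) : R :=
  match x, y with
  | Some z, Some w =>
      2 * modulus (z - w)
        / (Num.sqrt (1 + modulus z ^+ 2) * Num.sqrt (1 + modulus w ^+ 2))
  | Some z, None | None, Some z => 2 / Num.sqrt (1 + modulus z ^+ 2)
  | None, None => 0
  end.

(* Normality in the sense of Montel: locally uniform convergence of
   subsequences for the spherical metric, the constant infinity being allowed
   as a limit. *)
Definition normal_family (R : realType) (F : set (sphere R -> sphere R))
    (U : set (sphere R)) : Prop :=
  forall g : nat -> sphere R -> sphere R, (forall n, F (g n)) ->
  exists (phi : nat -> nat) (f : sphere R -> sphere R),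
    {homo phi : m n / (m < n)%N} /\
    forall K : set (sphere R), compact K -> K `<=` U ->
    forall eps : R, 0 < eps ->
    \forall n \near \oo, forall x, K x -> chordal (g (phi n) x) (f x) < eps.

(* Holomorphic coordinates centred at a point: z - c at c, 1 / z at infinity.
   [chart x] is only meaningful on the domain of the chart (the complex plane,
   resp. the complement of 0); outside it takes a dummy value. *)
Definition chart_inv (R : realType) (x : sphere R) (w : cplx R) : sphere R :=
  match x with
  | Some c => finite_pt (c + w)
  | None => if w == 0 then infty else finite_pt w^-1
  end.

Definition chart (R : realType) (x y : sphere R) : cplx R :=
  match x, y with
  | Some c, Some z => z - c
  | Some _, None => 0
  | None, Some z => z^-1
  | None, None => 0
  end.

Definition critical_point (R : realType) (f : sphere R -> sphere R)
    (x : sphere R) : Prop :=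
  is_derive (0 : cplx R) (1 : cplx R)
    (fun w : cplx R => chart (f x) (f (chart_inv x w))) (0 : cplx R).

Definition critical_values (R : realType) (f : sphere R -> sphere R) :
    set (sphere R) :=
  f @` [set x | critical_point f x].

Definition deg (R : realType) (g : {poly R[i]}) : nat := (size g).-1.

Definition sphere_map (R : realType) (g : {poly R[i]}) (x : sphere R) :
    sphere R :=
  match x with
  | Some z => finite_pt g.[z]
  | None => if (0 < deg g)%N then infty else finite_pt g`_0
  end.

(* Over the infinite field R[i] a polynomial is determined by the map it
   induces, so semigroups of polynomial maps are sets of polynomials closed
   under [\Po]. *)
Inductive generated (R : realType) (H : set {poly R[i]}) : set {poly R[i]} :=
  | generated_gen h : H h -> generated H h
  | generated_comp f g :
      generated H f -> generated H g -> generated H (f \Po g).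

Definition polynomial_semigroup (R : realType) (G : set {poly R[i]}) : Prop :=
  exists H : set {poly R[i]},
    [/\ H !=set0, (forall h, H h -> (0 < deg h)%N) & G = generated H].

Definition semigroup_maps (R : realType) (G : set {poly R[i]}) :
    set (sphere R -> sphere R) :=
  @sphere_map R @` G.

Definition fatou_set (R : realType) (G : set {poly R[i]}) : set (sphere R) :=
  [set x | exists U : set (sphere R),
     [/\ open U, U x & normal_family (semigroup_maps G) U]].

Definition julia_set (R : realType) (G : set {poly R[i]}) : set (sphere R) :=
  ~` fatou_set G.

Definition postcritical_set (R : realType) (G : set {poly R[i]}) :
    set (sphere R) :=
  closure (\bigcup_(g in G) critical_values (sphere_map g)).

(* As a subset of the plane: the preimage under [finite_pt] drops infinity. *)
Definition finite_postcritical_set (R : realType) (G : set {poly R[i]}) :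
    set (cplx R) :=
  finite_pt @^-1` postcritical_set G.

Definition postcritically_bounded (R : realType) (G : set {poly R[i]}) : Prop :=
  [/\ polynomial_semigroup G,
      (forall g, G g -> (2 <= deg g)%N) &
      bounded_set (finite_postcritical_set G)].

Definition Psi (R : realType) (g : {poly R[i]}) (x : R) : R :=
  (deg g)%:R * x + ln (modulus (lead_coef g)).

Definition Psi_fixpoint (R : realType) (g : {poly R[i]}) : R :=
  (- 1 / ((deg g)%:R - 1)) * ln (modulus (lead_coef g)).

Definition alpha (R : realType) (m : nat) (h : 'I_m.+1 -> {poly R[i]}) : R :=
  \big[Num.min/Psi_fixpoint (h ord0)]_(j < m.+1) Psi_fixpoint (h j).

Definition beta (R : realType) (m : nat) (h : 'I_m.+1 -> {poly R[i]}) : R :=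
  \big[Num.max/Psi_fixpoint (h ord0)]_(j < m.+1) Psi_fixpoint (h j).

Lemma sphere_map_comp (R : realType) (f g : {poly R[i]}) :
  (0 < deg f)%N -> (0 < deg g)%N ->
  sphere_map (f \Po g) = sphere_map f \o sphere_map g.
Proof.
move=> df dg; apply/funext => -[z|] /=; first by rewrite horner_comp.
by rewrite dg /= df /deg size_comp_poly /= muln_gt0 df dg.
Qed.

(* Main.v *)
Require Import Defs.
From mathcomp Require Import all_boot all_order all_algebra.
From mathcomp Require Import complex.
From mathcomp Require Import all_classical all_reals all_analysis.
From mathcomp Require Import ring lra zify.

(* A sequence [w] of generators has a filled Julia set [K w] (the points whose orbit
   under the compositions [g w n] of the first [n] generators stays bounded) with
   boundary [J w]. As the finite critical values of the semigroup have modulus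
   less than [r], all level curves [{|g w n| = r}] are connected, and they
   approximate [J w]. Suppose that the Julia set is covered by disjoint open sets
   [U] and [V] both of which it meets. Each [J w] lies in the Julia set, hence in
   [U] or in [V], and both cases occur since the Julia set is the closure of the
   union of the [J w]. The sets [K w] have a common point, so [J w] in [U] and
   [J v] in [V] are nested and [K w], [K v] have different capacities. Now the
   logarithmic capacity of [K w] is the [x] with [Psi (g w n) x] in
   [[alpha, beta]] for all [n], and the covering hypothesis says that each [x] in
   [[alpha, beta]] has such a [w]. Hence [[alpha, beta]] is the disjoint union of
   the set of values [x] coming from [U] and of that coming from [V]. Both are
   closed, because [J w] is lower semicontinuous in [w], and this contradicts the
   connectedness of the interval.

   Harnack's inequality for [ln |p|] and the comparison of capacities need no
   integration for polynomials: both are product formulas over zeros. *)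

Set Implicit Arguments.
Unset Strict Implicit.
Unset Printing Implicit Defensive.
Import Order.TTheory GRing.Theory Num.Theory.
Import numFieldNormedType.Exports.
Local Open Scope classical_set_scope.
Local Open Scope ring_scope.

(** * Topology of the plane *)

Section Modulus.
Context {R : realType}.
Local Notation C := (cplx R).
Local Notation nc := (@Normc.normc R).
Implicit Types (z w c : C) (p q : {poly R[i]}) (r e : R).

(** Green's functions of the sets [K w] never appear; finite stages play their role. One radius [r]
    serves three purposes. An orbit reaching modulus [r] escapes, so the sets [{|g w n| < r}]
    decrease to [K w]. All critical values of words are below [r], which governs the shape of the
    level curves. Finally [beta h < ln r], which leaves a strict gap between the capacity of a level
    curve and the value [x] of its word, so that a level curve of one fiber cannot lie in the filled
    Julia set of another fiber with the same [x]. The delicate point is the passage to limits of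
    words, since [J w] need not depend continuously on [w]. Lower semicontinuity suffices because
    each [J w] lies entirely on one side: a point of [J w] in [V] would force the fibers of all
    words close to [w] to meet [V], so none of them could lie in [U]. *)

Lemma modulus_ge0 z : 0 <= nc z.
Proof. by case: z => a b /=; exact: sqrtr_ge0. Qed.

Lemma modulus0 : nc 0 = 0. Proof. exact: Normc.normc0. Qed.
Lemma modulus1 : nc 1 = 1. Proof. exact: Normc.normc1. Qed.

Lemma modulus_eq0 z : (nc z == 0) = (z == 0).
Proof.
by apply/eqP/eqP => [/Normc.eq0_normc //|->]; exact: modulus0.
Qed.

Lemma modulus_gt0 z : (0 < nc z) = (z != 0).
Proof. by rewrite lt_neqAle modulus_ge0 andbT eq_sym modulus_eq0. Qed.

Lemma modulusM z w : nc (z * w) = nc z * nc w.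
Proof. exact: Normc.normcM. Qed.

Lemma modulusV (z : R[i]) : nc z^-1 = (nc z)^-1.
Proof. exact: Normc.normcV. Qed.

Lemma modulusN z : nc (- z) = nc z.
Proof. exact: normcN. Qed.

Lemma modulus_distC z w : nc (z - w) = nc (w - z).
Proof. by rewrite -modulusN opprB. Qed.

Lemma modulusD z w : nc (z + w) <= nc z + nc w.
Proof. exact: le_normcD. Qed.

Lemma modulusB z w : nc (z - w) <= nc z + nc w.
Proof. by rewrite -(modulusN w); exact: modulusD. Qed.

Lemma modulus_triangle z w c : nc (z - c) <= nc (z - w) + nc (w - c).
Proof. by have := modulusD (z - w) (w - c); rewrite addrA subrK. Qed.

Lemma modulusB_ge z w : nc z - nc w <= nc (z - w).
Proof. by rewrite lerBlDr; have := modulusD (z - w) w; rewrite subrK. Qed.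

Lemma modulusD_ge z w : nc z - nc w <= nc (z + w).
Proof. by have := modulusB_ge z (- w); rewrite modulusN opprK. Qed.

Lemma modulus_dist_le z w : `|nc z - nc w| <= nc (z - w).
Proof.
by rewrite ler_norml modulusB_ge andbT lerNl opprB modulus_distC modulusB_ge.
Qed.

Lemma modulusX (z : R[i]) n : nc (z ^+ n) = nc z ^+ n.
Proof. by elim: n => [|n IH]; rewrite ?expr0 ?modulus1// !exprS modulusM IH. Qed.

Lemma modulus_prod I (s : seq I) (P : pred I) (F : I -> R[i]) :
  nc (\prod_(i <- s | P i) F i) = \prod_(i <- s | P i) nc (F i).
Proof. by rewrite (big_morph nc (fun z w => modulusM z w) modulus1). Qed.

Lemma modulus_sum I (s : seq I) (P : pred I) (F : I -> R[i]) :
  nc (\sum_(i <- s | P i) F i) <= \sum_(i <- s | P i) nc (F i).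
Proof.
elim/big_rec2 : _ => [|i y x _ IH]; first by rewrite modulus0.
by apply: (le_trans (modulusD _ _)); rewrite lerD2l.
Qed.

Lemma modulus_real (x : R) : nc (x%:C)%C = `|x|.
Proof. by rewrite /= expr0n /= addr0 sqrtr_sqr. Qed.

Lemma norm_modulus z : `|z| = ((nc z)%:C)%C.
Proof. by []. Qed.

Lemma real_complex_gt0 (r : R) : ((0 : R[i]) < (r%:C)%C) = (0 < r).
Proof. exact: (ltcR 0 r). Qed.

(** The norm of [C] is [R[i]]-valued. This trades its balls for real radii, the form in which
    neighborhoods in the plane are used later. *)
Lemma nbhs_modulusP z (A : set C) :
  nbhs z A <-> exists2 e : R, 0 < e & forall w, nc (w - z) < e -> A w.
Proof.
split.
  move=> /nbhs_ballP [e /= e0 H].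
  have [re ree] : exists re : R, e = (re%:C)%C.
    exists (complex.Re e); move: e0 => /=; rewrite ltcE; by case: (e) => a b /= /andP[/eqP -> _].
  exists re; first by rewrite -real_complex_gt0 -ree.
  move=> w wz; apply: H; rewrite -ball_normE /= norm_modulus ree.
  by rewrite ltcR modulus_distC.
move=> [e e0 H]; apply/nbhs_ballP; exists (e%:C)%C => /=.
  by rewrite real_complex_gt0.
by move=> w; rewrite -ball_normE /= norm_modulus ltcR modulus_distC; apply: H.
Qed.

Lemma nbhs_modulus z r : 0 < r -> nbhs z [set w : C | nc (w - z) < r].
Proof. by move=> r0; apply/nbhs_modulusP; exists r. Qed.

Lemma modulus_continuous : continuous (nc : C -> R).
Proof.
move=> z A /nbhs_ballP [e e0 H]; apply/nbhs_modulusP; exists e => // w wz.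
apply: H; rewrite -ball_normE /=.
by apply: le_lt_trans wz; rewrite modulus_distC modulus_dist_le.
Qed.

Lemma horner_local_lipschitz p z :
  exists2 L, 0 <= L & forall w, nc (w - z) <= 1 -> nc (p.[w] - p.[z]) <= L * nc (w - z).
Proof.
elim/poly_ind: p => [|p c [L L0 IH]].
  by exists 0 => // w _; rewrite !horner0 subrr modulus0 mul0r.
exists (L * (nc z + 1) + nc p.[z]) => [|w wz].
  by rewrite addr_ge0 ?mulr_ge0 ?addr_ge0 ?modulus_ge0.
rewrite !hornerMXaddC.
have -> : p.[w] * w + c - (p.[z] * z + c) = (p.[w] - p.[z]) * w + p.[z] * (w - z) by ring.
rewrite [leRHS]mulrDl; apply: (le_trans (modulusD _ _)).
rewrite !modulusM; apply: lerD; last by [].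
rewrite -mulrA [(_ + 1) * _]mulrC mulrA; apply: ler_pM; rewrite ?modulus_ge0 ?IH //.
by have := modulusD (w - z) z; rewrite subrK => /le_trans; apply; rewrite addrC lerD2l.
Qed.

Lemma horner_continuous p : continuous (fun z : C => p.[z] : C).
Proof.
move=> z A /nbhs_modulusP [e e0 H]; have [L L0 HL] := horner_local_lipschitz p z.
have L1 : 0 < L + 1 by rewrite ltr_wpDl.
apply/nbhs_modulusP; exists (Num.min 1 (e / (L + 1))).
  by rewrite lt_min ltr01 divr_gt0.
move=> w; rewrite lt_min => /andP[w1]; rewrite ltr_pdivlMr // => we.
apply: H; apply: (le_lt_trans (HL _ (ltW w1))); apply: le_lt_trans we.
by rewrite mulrC ler_wpM2l ?modulus_ge0 // lerDl.
Qed.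

Lemma horner_continuity p z e : 0 < e ->
  exists2 d, 0 < d & forall w, nc (w - z) < d -> nc (p.[w] - p.[z]) < e.
Proof.
by move=> e0; exact/nbhs_modulusP/(horner_continuous (nbhs_modulus _ e0)).
Qed.

Lemma modulus_horner_continuous p : continuous (fun z : C => nc p.[z] : R).
Proof.
move=> z; apply: (@continuous_comp C C R (fun z => p.[z]) nc).
  exact: horner_continuous.
exact: modulus_continuous.
Qed.

Lemma modulus_dist_continuous c : continuous (fun z : C => nc (z - c) : R).
Proof.
have -> : (fun z : C => nc (z - c)) = (fun z : C => nc ('X - c%:P).[z]).
  by apply/funext => z; rewrite hornerXsubC.
exact: modulus_horner_continuous.
Qed.

Lemma closed_sublevel (f : C -> R) r : continuous f -> closed [set z : C | f z <= r].
Proof.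
move=> cf; rewrite (_ : [set _ | _] = f @^-1` [set y | y <= r]) //.
by apply: closed_comp; [move=> z _; exact: cf|exact: closed_le].
Qed.

Lemma closed_superlevel (f : C -> R) r : continuous f -> closed [set z : C | r <= f z].
Proof.
move=> cf; rewrite (_ : [set _ | _] = f @^-1` [set y | r <= y]) //.
by apply: closed_comp; [move=> z _; exact: cf|exact: closed_ge].
Qed.

Lemma open_sublevel (f : C -> R) r : continuous f -> open [set z : C | f z < r].
Proof.
move=> cf; rewrite (_ : [set _ | _] = f @^-1` [set y | y < r]) //.
by apply: open_comp; [move=> z _; exact: cf|exact: open_lt].
Qed.

Lemma open_superlevel (f : C -> R) r : continuous f -> open [set z : C | r < f z].
Proof.
move=> cf; rewrite (_ : [set _ | _] = f @^-1` [set y | r < y]) //.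
by apply: open_comp; [move=> z _; exact: cf|exact: open_gt].
Qed.

Lemma modulus_le_ReIm (x y : R) : nc (x +i* y)%C <= `|x| + `|y|.
Proof.
rewrite [X in nc X](complexE (x +i* y)%C).
apply: (le_trans (modulusD _ _)); rewrite modulusM !modulus_real.
by rewrite /= expr0n expr1n /= add0r sqrtr1 mul1r.
Qed.

Lemma complex_mk_continuous : continuous (fun x : R * R => (x.1 +i* x.2)%C : C).
Proof.
move=> [a b] A /nbhs_modulusP [e e0 H].
have e2 : 0 < e / 2 by rewrite divr_gt0.
exists (ball a (e / 2), ball b (e / 2)); first by split; exact: nbhsx_ballx.
move=> [x y] /= [xa yb]; apply: H => /=.
apply: (le_lt_trans (modulus_le_ReIm (x - a) (y - b))).
move: xa yb; rewrite -!ball_normE /= => xa yb.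
by rewrite [e]splitr ltrD // distrC.
Qed.

Lemma Re_le_modulus z : `|complex.Re z| <= nc z.
Proof.
case: z => a b /=; rewrite -sqrtr_sqr ler_wsqrtr // lerDl sqr_ge0 //.
Qed.

Lemma Im_le_modulus z : `|complex.Im z| <= nc z.
Proof.
case: z => a b /=; rewrite -sqrtr_sqr ler_wsqrtr // lerDr sqr_ge0 //.
Qed.

(** Heine-Borel, transported from a square in [R * R]. *)
Lemma compact_bounded_closed r (A : set C) :
  closed A -> (forall z, A z -> nc z <= r) -> compact A.
Proof.
move=> cA Ar; apply: (@subclosed_compact _ _ ((fun x : R * R => (x.1 +i* x.2)%C : C) @` (`[-r, r] `*` `[-r, r]))) => //.
  apply: continuous_compact; first exact/continuous_subspaceT/complex_mk_continuous.
  by apply: compact_setX; exact: segment_compact.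
move=> z /Ar zr; exists (complex.Re z, complex.Im z); last by case: (z).
split=> /=; rewrite in_itv /= -ler_norml; apply: le_trans zr.
  exact: Re_le_modulus.
exact: Im_le_modulus.
Qed.

Lemma compact_disc c r : compact [set z : C | nc (z - c) <= r].
Proof.
apply: (@compact_bounded_closed (r + nc c)).
  exact/closed_sublevel/modulus_dist_continuous.
by move=> z /= zr; have := modulusD (z - c) c; rewrite subrK => /le_trans; apply; rewrite lerD2r.
Qed.

Definition segment_path (a b : C) (t : R) : C := a + (t%:C)%C * (b - a).

Lemma segment_path_continuous a b : continuous (segment_path a b).
Proof.
move=> t A /nbhs_modulusP [e e0 H].
have d0 : 0 < nc (b - a) + 1 by rewrite ltr_wpDl ?modulus_ge0.
apply/nbhs_ballP; exists (e / (nc (b - a) + 1)); first by rewrite /= divr_gt0.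
move=> s; rewrite -ball_normE /= => st; apply: H.
rewrite /segment_path opprD addrACA subrr add0r -mulrBl -rmorphB modulusM modulus_real.
have [->|ba] := eqVneq (nc (b - a)) 0; first by rewrite mulr0.
rewrite -ltr_pdivlMr; last by rewrite lt_neqAle eq_sym ba modulus_ge0.
rewrite distrC; apply: (lt_trans st); rewrite ltr_pM2l // ltf_pV2 ?posrE //.
  by rewrite ltrDl.
by rewrite lt_neqAle eq_sym ba modulus_ge0.
Qed.

Definition segment (a b : C) : set C := segment_path a b @` `[0, 1].

Lemma segment_connected_cplx a b : connected (segment a b).
Proof.
apply: connected_continuous_connected; first exact: segment_connected.
exact/continuous_subspaceT/segment_path_continuous.
Qed.

Lemma segment_left a b : segment a b a.
Proof.
exists 0; first by rewrite /= in_itv /= lexx ler01.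
by rewrite /segment_path mul0r addr0.
Qed.

Lemma segment_right a b : segment a b b.
Proof.
exists 1; first by rewrite /= in_itv /= lexx ler01.
by rewrite /segment_path mul1r addrC subrK.
Qed.

Lemma segment_disc c r a b : nc (a - c) <= r -> nc (b - c) <= r ->
  segment a b `<=` [set z | nc (z - c) <= r].
Proof.
move=> ar br _ [t /= + <-]; rewrite in_itv /= => /andP[t0 t1].
rewrite /segment_path.
have -> : a + (t%:C)%C * (b - a) - c = ((1 - t)%:C)%C * (a - c) + (t%:C)%C * (b - c) :> R[i].
  by rewrite rmorphB rmorph1; ring.
apply: (le_trans (modulusD _ _)); rewrite !modulusM !modulus_real !ger0_norm ?subr_ge0 //.
have -> : r = (1 - t) * r + t * r by ring.
by apply: lerD; apply: ler_wpM2l => //; rewrite subr_ge0.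
Qed.

Lemma connected_of_segments (A : set C) c : A c ->
  (forall z, A z -> exists2 B, connected B & [/\ B c, B z & B `<=` A]) -> connected A.
Proof.
move=> Ac H.
rewrite (_ : A = connected_component A c); first exact: component_connected.
apply/seteqP; split; last exact: connected_component_sub.
by move=> z /H [B cB [Bc Bz BA]]; exists B.
Qed.

Lemma disc_connected c r : 0 <= r -> connected [set z : C | nc (z - c) <= r].
Proof.
move=> r0; have cc : nc (c - c) <= r by rewrite subrr modulus0.
apply: (@connected_of_segments _ c) => //= z zr; exists (segment c z).
  exact: segment_connected_cplx.
by split; [exact: segment_left|exact: segment_right|exact: segment_disc].
Qed.

Lemma open_disc_connected c r : 0 < r -> connected [set z : C | nc (z - c) < r].
Proof.
move=> r0; have cc : nc (c - c) < r by rewrite subrr modulus0.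
apply: (@connected_of_segments _ c) => //= z zr; exists (segment c z).
  exact: segment_connected_cplx.
split; [exact: segment_left|exact: segment_right|].
move=> x Hx; apply: (le_lt_trans _ zr); apply: (segment_disc _ _ Hx) => //.
by rewrite subrr modulus0 modulus_ge0.
Qed.

Lemma connected_cplx : connected [set: C].
Proof.
apply: (@connected_of_segments _ 0) => //= z _; exists (segment 0 z).
  exact: segment_connected_cplx.
by split; [exact: segment_left|exact: segment_right|].
Qed.

Definition unit_path (t : R) : C := (cos t +i* sin t)%C.

Lemma modulus_unit_path t : nc (unit_path t) = 1.
Proof. by rewrite /= cos2Dsin2 sqrtr1. Qed.

Lemma unit_pathD s t : unit_path (s + t) = unit_path s * unit_path t.
Proof.
by apply/eqP; rewrite eq_complex /= cosD sinD; apply/andP; split; apply/eqP; ring.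
Qed.

Lemma unit_path_continuous : continuous unit_path.
Proof.
move=> t; apply: (@continuous_comp R (R * R)%type C (fun t => (cos t, sin t)) (fun x => (x.1 +i* x.2)%C)).
  exact: (cvg_pair (@continuous_cos R t) (@continuous_sin R t)).
exact: complex_mk_continuous.
Qed.

End Modulus.

(** * Estimates for polynomials *)

Section MaximumPrinciple.
Context {R : realType}.
Local Notation C := (cplx R).
Local Notation nc := (@Normc.normc R).
Implicit Types (z w c x y : C) (p q : {poly R[i]}) (r e : R).

(** Write [p = p(z) + s (X - z)^k] with [s(z)] nonzero. A small step along [v] with
    [v^k = p(z) / s(z)] changes [p] by nearly a positive multiple of [p(z)], so the modulus
    grows. *)
Lemma modulus_horner_no_local_max p z e : (1 < size p)%N -> 0 < e ->
  exists2 w, nc (w - z) < e & nc p.[z] < nc p.[w].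
Proof.
move=> sp e0.
have [k [s s0 Eps]] := multiplicity_XsubC (p - (p.[z])%:P) (z : R[i]).
have p0 : p - (p.[z])%:P != 0.
  rewrite subr_eq0; apply: contraTN sp => /eqP ->.
  by rewrite -leqNgt size_polyC leq_b1.
move: s0; rewrite p0 /= => s0.
have k0 : (0 < k)%N.
  rewrite lt0n; apply/eqP => k0; move: s0; rewrite k0 expr0 mulr1 in Eps.
  by rewrite -Eps rootE hornerD hornerN hornerC subrr eqxx.
have pE w : p.[w] = p.[z] + s.[w] * (w - z) ^+ k.
  have := congr1 (fun q => q.[w]) Eps.
  rewrite hornerD hornerN hornerC hornerM horner_exp hornerXsubC => <-.
  by rewrite addrC subrK.
rewrite rootE in s0.
have s0' : 0 < nc s.[z] by rewrite modulus_gt0.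
(* If [p(z) = 0], every direction increases the modulus and 1 is as good as any. *)
pose a : R[i] := if p.[z] == 0 then 1 else p.[z] / s.[z].
pose v : R[i] := k.-root a.
have vk : v ^+ k = a by rewrite /v rootCK.
have [|d d0 Hd] := @horner_continuity R s z (nc s.[z] / 2); first by rewrite divr_gt0.
pose t := Num.min e d / (nc v + 1) / 2.
have v1 : 0 < nc v + 1 by rewrite ltr_wpDl ?modulus_ge0.
have m0 : 0 < Num.min e d by rewrite lt_min e0.
have t0 : 0 < t by rewrite !divr_gt0.
pose w : C := z + (t%:C)%C * v.
have wz : nc (w - z) < Num.min e d.
  rewrite /w addrC addKr modulusM modulus_real gtr0_norm // /t.
  have : nc v / (nc v + 1) <= 1 by rewrite ler_pdivrMr // mul1r lerDl.
  move: (nc v) v1 => u u1; nra.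
move: wz; rewrite lt_min => /andP[we /Hd /= wd].
exists w => //.
have wk : (w - z) ^+ k = ((t ^+ k)%:C)%C * a.
  by rewrite /w addrC addKr exprMn vk rmorphXn.
have tk0 : 0 < t ^+ k by rewrite exprn_gt0.
rewrite (pE w) wk {wk we}.
have [z0|z0] := eqVneq p.[z] 0.
  rewrite z0 add0r modulus0 modulus_gt0 /a z0 eqxx mulr1 mulf_neq0 //.
    apply/eqP => sw; move: wd; rewrite sw sub0r modulusN.
    by move: s0' => ? ?; lra.
  by rewrite -modulus_gt0 modulus_real gtr0_norm.
have -> : p.[z] + s.[w] * (((t ^+ k)%:C)%C * a) =
    p.[z] * (((1 + t ^+ k)%:C)%C + ((t ^+ k)%:C)%C * ((s.[w] - s.[z]) / s.[z])).
  rewrite /a (negbTE z0) rmorphD rmorph1.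
  by field.
rewrite modulusM -{1}[nc p.[z]]mulr1 ltr_pM2l; last by rewrite modulus_gt0.
apply: lt_le_trans (modulusD_ge _ _).
rewrite modulusM !modulus_real modulusM modulusV !gtr0_norm //; last by rewrite addr_gt0.
have : nc (s.[w] - s.[z]) / nc s.[z] < 1 / 2 by rewrite ltr_pdivrMr // mulrC mul1r.
move: (nc _ / nc _) => u; nra.
Qed.

Lemma compact_modulus_max p (A : set C) : compact A -> A !=set0 ->
  exists2 m, A m & forall z, A z -> nc p.[z] <= nc p.[m].
Proof.
move=> cA A0; have [|m mA mP] := @compact_EVT_max _ R (fun z => nc p.[z]) A A0 cA.
  exact/continuous_subspaceT/modulus_horner_continuous.
by exists m; [rewrite inE in mA|move=> z Az; apply: mP; rewrite inE].
Qed.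

Lemma maximum_principle p c r B x :
  (forall z, nc (z - c) = r -> nc p.[z] <= B) -> nc (x - c) <= r -> nc p.[x] <= B.
Proof.
move=> HB xr; have r0 : 0 <= r by apply: le_trans xr; exact: modulus_ge0.
have [sp|sp] := leqP (size p) 1.
  have pE z : p.[z] = p`_0 by rewrite {1}(size1_polyC sp) hornerC.
  have := HB (c + (r%:C)%C); rewrite !pE; apply.
  by rewrite addrC addKr modulus_real ger0_norm.
have [|m mr mP] := compact_modulus_max p (@compact_disc R c r); first by exists x.
have [mr'|mr'] := eqVneq (nc (m - c)) r.
  exact: le_trans (mP x xr) (HB _ mr').
have mr0 : 0 < r - nc (m - c) by rewrite subr_gt0 lt_neqAle mr'.
have [w wm pw] := modulus_horner_no_local_max m sp mr0.
suff /mP : nc (w - c) <= r by rewrite leNgt pw.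
by have := modulus_triangle w m c; move: wm => ? ?; lra.
Qed.

(** The difference quotient of [p] at [y] is itself a polynomial. On the circle of radius [r] its
    denominator is at least [r / 2] and its numerator at most [2 B]; the maximum principle carries
    the bound inside. *)
Lemma bounded_horner_lipschitz p c r B x y : 0 < r ->
  (forall z, nc (z - c) <= r -> nc p.[z] <= B) ->
  nc (x - c) <= r / 2 -> nc (y - c) <= r / 2 ->
  nc (p.[x] - p.[y]) <= 4 * B / r * nc (x - y).
Proof.
move=> r0 HB xr yr.
have : root (p - (p.[y])%:P) y by rewrite rootE hornerD hornerN hornerC subrr.
case/factor_theorem => q Eq.
have qE z : q.[z] * (z - y) = p.[z] - p.[y].
  by have := congr1 (fun q => q.[z]) Eq; rewrite hornerM hornerXsubC hornerD hornerN hornerC => ->.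
rewrite -qE modulusM ler_wpM2r ?modulus_ge0 //.
apply: (@maximum_principle _ c r) => [z zr|]; last by move: xr => ?; lra.
have zy : r / 2 <= nc (z - y).
  by have := modulus_triangle z y c; rewrite zr; move: yr => ? ?; lra.
have : nc (q.[z] * (z - y)) <= 2 * B.
  rewrite qE; apply: (le_trans (modulusB _ _)).
  have := HB y _; have := HB z; rewrite zr lexx => /(_ isT) ? H.
  by have := H ltac:(move: yr => ?; lra) => ?; lra.
rewrite modulusM => H; rewrite ler_pdivlMr //.
have : nc q.[z] * (r / 2) <= 2 * B.
  by apply: le_trans H; rewrite ler_wpM2l ?modulus_ge0.
by move=> ?; lra.
Qed.

Lemma bernoulli_inequality (h : R) n : 0 <= h -> 1 + n%:R * h <= (1 + h) ^+ n.
Proof.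
move=> h0; elim: n => [|n IH]; first by rewrite mul0r addr0 expr0.
rewrite exprS -natr1; have n0 : 0 <= n%:R :> R by rewrite ler0n.
nra.
Qed.

(** Removes a constant factor: an inequality known for all powers up to one fixed factor holds
    exactly. *)
Lemma expr_bounded_le1 (x B : R) : (forall n, x ^+ n <= B) -> x <= 1.
Proof.
move=> H; rewrite leNgt; apply/negP => x1.
have h0 : 0 < x - 1 by rewrite subr_gt0.
have := H (Num.bound (B / (x - 1))); apply/negP; rewrite -ltNge.
have := @bernoulli_inequality (x - 1) (Num.bound (B / (x - 1))) (ltW h0).
rewrite [1 + (x - 1)]addrC subrK; apply: lt_le_trans.
apply: (@lt_trans _ _ ((Num.bound (B / (x - 1)))%:R * (x - 1))).
  rewrite -ltr_pdivrMr //; apply: archi_boundP; rewrite divr_ge0 ?ltW //.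
  by have := H 0; rewrite expr0; apply: lt_le_trans.
by rewrite ltrDr.
Qed.

Lemma ler_prod_seq (s : seq R[i]) (F G : R[i] -> R) :
  (forall z, z \in s -> 0 <= F z <= G z) ->
  \prod_(z <- s) F z <= \prod_(z <- s) G z.
Proof.
move=> H; rewrite big_seq [leRHS]big_seq; apply: ler_prod => z; exact: H.
Qed.

Lemma poly_factors p : exists s : seq R[i],
  p = lead_coef p *: \prod_(z <- s) ('X - z%:P).
Proof. by have [s] := closed_field_poly_normal p; exists s. Qed.

Lemma horner_factors (a : R[i]) (s : seq R[i]) (x : R[i]) :
  (a *: \prod_(z <- s) ('X - z%:P)).[x] = a * \prod_(z <- s) (x - z).
Proof.
rewrite hornerZ horner_prod; congr (_ * _).
by apply: eq_bigr => z _; rewrite hornerXsubC.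
Qed.

Lemma size_factors (a : R[i]) (s : seq R[i]) : a != 0 ->
  (size (a *: \prod_(z <- s) ('X - z%:P))).-1 = size s.
Proof. by move=> a0; rewrite size_scale // size_prod_XsubC. Qed.

End MaximumPrinciple.

(** * Harnack's inequality and comparison of capacities by products over zeros *)

Section HarnackCapacity.
Context {R : realType}.
Local Notation C := (cplx R).
Local Notation nc := (@Normc.normc R).
Implicit Types (z w c x y : C) (p q : {poly R[i]}) (r e : R).

(* [sum_(j <= n) 'C(2n+1, j) (y - c)^j (X - y)^(n - j)]: the terms of
   [(X - c)^(2n+1) = ((X - y) + (y - c))^(2n+1)] divisible by [(X - y)^(n+1)]. *)
Definition binomial_half (c y : R[i]) (n : nat) : {poly R[i]} :=
  \sum_(j < n.+1) ('C(2 * n + 1, j)%:R * (y - c) ^+ j) *: ('X - y%:P) ^+ (n - j).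

Lemma binomial_half_lead (c y : R[i]) n :
  size (binomial_half c y n) = n.+1 /\ lead_coef (binomial_half c y n) = 1.
Proof.
rewrite /binomial_half big_ord_recl /= subn0 bin0 expr0 mulr1 scale1r.
set S := \sum_(i < n) _.
have Sn : (size S < size (('X - y%:P) ^+ n))%N.
  rewrite size_exp_XsubC ltnS; apply: (leq_trans (size_sum _ _ _)).
  apply/bigmax_leqP => i _; apply: (leq_trans (size_scale_leq _ _)).
  by rewrite size_exp_XsubC /bump /= add1n subnSK // leq_subr.
rewrite size_polyDl // lead_coefDl // size_exp_XsubC; split=> //.
by apply/monicP; rewrite monic_exp // monicXsubC.
Qed.

(** The difference consists of the terms with at least [n + 1] factors [y - c]. As
    [|y - c| <= D / 8] and [|z - y| <= 9 D / 8], each is at most a binomial coefficient times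
    [(9 D / 8)^n (D / 8)^(n+1)]. The coefficients sum to at most [2^(2n+1)], which leaves
    [(9/16)^n D^(2n+1) / 4]. *)
Lemma binomial_half_bound c y z n : nc (y - c) <= nc (z - c) / 8 ->
  nc ((z - c) ^+ (2 * n + 1) - (z - y) ^+ n.+1 * (binomial_half c y n).[z])
    <= nc (z - c) ^+ (2 * n + 1) / 4.
Proof.
move=> yc; set D := nc (z - c).
have -> : (z - c) ^+ (2 * n + 1) - (z - y) ^+ n.+1 * (binomial_half c y n).[z] =
  \sum_(j < n.+1) ((z - y) ^+ (n - j) * (y - c) ^+ (n.+1 + j)) *+ 'C(2 * n + 1, n.+1 + j).
  have -> : z - c = (z - y) + (y - c) :> R[i] by rewrite addrA subrK.
  have E : (2 * n + 1).+1 = (n.+1 + n.+1)%N by lia.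
  rewrite exprDn E big_split_ord /= /binomial_half horner_sum mulr_sumr.
  rewrite addrAC -sumrB big1 ?add0r => [|i _].
    apply: eq_bigr => i _; congr (_ ^+ _ * _ *+ _); lia.
  rewrite hornerZ horner_exp hornerXsubC; have i_n : (i <= n)%N by rewrite -ltnS.
  have -> : (2 * n + 1 - i = n.+1 + (n - i))%N by lia.
  by rewrite exprD -mulr_natl; ring.
apply: (le_trans (modulus_sum _ _ _)).
have D0 : 0 <= D by exact: modulus_ge0.
have zy : nc (z - y) <= 9 / 8 * D.
  have := modulus_triangle z c y; rewrite (modulus_distC c y) -/D.
  by move: yc; rewrite -/D => ? ?; lra.
have term (j : 'I_n.+1) : nc (((z - y) ^+ (n - j) * (y - c) ^+ (n.+1 + j)) *+ 'C(2 * n + 1, n.+1 + j))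
   <= 'C(2 * n + 1, n.+1 + j)%:R * ((9 / 8 * D) ^+ n * (D / 8) ^+ n.+1).
  rewrite normcMn -[leLHS]mulr_natl ler_wpM2l ?ler0n // modulusM !modulusX.
  have jn : (j <= n)%N by rewrite -ltnS.
  have D9 : 0 <= 9 / 8 * D by rewrite mulr_ge0.
  have yD : nc (y - c) <= 9 / 8 * D by apply: le_trans yc _; rewrite -/D; lra.
  rewrite [nc (y - c) ^+ _]exprD mulrCA [leRHS]mulrC.
  have -> : (9 / 8 * D) ^+ n = (9 / 8 * D) ^+ (n - j) * (9 / 8 * D) ^+ j.
    by rewrite -exprD subnK.
  apply: ler_pM; rewrite ?exprn_ge0 ?mulr_ge0 ?exprn_ge0 ?modulus_ge0 //.
    by apply: lerXn2r; rewrite ?nnegrE ?modulus_ge0 ?divr_ge0.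
  apply: ler_pM; rewrite ?exprn_ge0 ?modulus_ge0 //.
    by apply: lerXn2r; rewrite ?nnegrE ?modulus_ge0.
  by apply: lerXn2r; rewrite ?nnegrE ?modulus_ge0.
apply: (le_trans (ler_sum _ (fun j _ => term j))).
rewrite -mulr_suml.
have binle : \sum_(j < n.+1) ('C(2 * n + 1, n.+1 + j)%:R : R) <= 2 ^+ (2 * n + 1).
  have -> : (2 : R) ^+ (2 * n + 1) = (1 + 1) ^+ (2 * n + 1) by [].
  have E : (2 * n + 1).+1 = (n.+1 + n.+1)%N by lia.
  rewrite exprDn E big_split_ord /=.
  under [X in _ + X]eq_bigr do rewrite !expr1n mul1r.
  by rewrite lerDr sumr_ge0 // => i _; rewrite !expr1n mul1r ler0n.
apply: (@le_trans _ _ (2 ^+ (2 * n + 1) * ((9 / 8 * D) ^+ n * (D / 8) ^+ n.+1))).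
  by rewrite ler_wpM2r // mulr_ge0 // exprn_ge0 // ?mulr_ge0 // divr_ge0.
have -> : 2 ^+ (2 * n + 1) * ((9 / 8 * D) ^+ n * (D / 8) ^+ n.+1) =
    (9 / 16) ^+ n * (D ^+ (2 * n + 1) / 4).
  have -> : (2 * n + 1)%N = (n + n).+1 by lia.
  rewrite !exprS !exprD !exprMn !exprVn -!exprVn.
  have -> : (8^-1 : R) ^+ n = (2^-1) ^+ n * (2^-1) ^+ n * (2^-1) ^+ n.
    by rewrite -!exprMn; congr (_ ^+ n); field.
  have -> : (16^-1 : R) ^+ n = (2^-1) ^+ n * (2^-1) ^+ n * (2^-1) ^+ n * (2^-1) ^+ n.
    by rewrite -!exprMn; congr (_ ^+ n); field.
  have : (2 : R) ^+ n * (2^-1) ^+ n = 1 by rewrite -exprMn divff ?expr1n.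
  move: (2 ^+ n) ((2^-1) ^+ n) (9 ^+ n) (D ^+ n) => a b u v ab.
  have -> : 2 * (a * a) * (u * (b * b * b) * v * (D / 8 * (v * (b * b * b)))) =
    (a * b) ^+ 2 * (u * (b * b * b * b) * (D * (v * v) / 4)) by field.
  by rewrite ab expr1n mul1r.
rewrite ler_piMl ?divr_ge0 ?exprn_ge0 // exprn_ile1 //; lra.
Qed.

(* Apply the splitting of [(z - c)^(2n+1)] to all zeros [z] of [p] and let [n]
   go to infinity; the zeros of [binomial_half c y n] lie in the disc. *)
Lemma harnack p c r y : 0 < r ->
  (forall z, nc (z - c) <= r -> 1 <= nc p.[z]) ->
  nc (y - c) <= r / 8 -> nc p.[y] <= nc p.[c] ^+ 2.
Proof.
move=> r0 Hp yr.
have p0 : p != 0.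
  apply/eqP => p0; have := Hp c; rewrite p0 horner0 subrr modulus0 => /(_ (ltW r0)).
  by rewrite leNgt ltr01.
have [s Es] := poly_factors p; set a := lead_coef p in Es.
have a0 : a != 0 by rewrite lead_coef_eq0.
have sr z : z \in s -> r < nc (z - c).
  move=> zs; rewrite ltNge; apply/negP => /Hp.
  rewrite Es horner_factors (big_rem z) //= subrr mul0r mulr0 modulus0.
  by rewrite leNgt ltr01.
have pc1 : 1 <= nc p.[c] by apply: Hp; rewrite subrr modulus0 ltW.
have pc0 : 0 < nc p.[c] ^+ 2 by rewrite exprn_gt0 // (lt_le_trans ltr01).
rewrite -[leRHS]mul1r -ler_pdivrMr //.
apply: (@expr_bounded_le1 _ _ ((5 / 4) ^+ size s)) => -[|n].
  by rewrite expr0 exprn_ege1 //; lra.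
have [Ss Sl] := binomial_half_lead c y n.
set S := binomial_half c y n in Ss Sl.
have Sb z : nc (y - c) <= nc (z - c) / 8 ->
    nc ((z - y) ^+ n.+1 * S.[z]) <= nc (z - c) ^+ (2 * n + 1) * (5 / 4).
  move=> /(binomial_half_bound n); rewrite -/S -modulusX.
  set u := (z - c) ^+ _; set v := _ * _ => H.
  by have := modulusB_ge v u; rewrite (modulus_distC v u); move: H; lra.
have [t Et] := poly_factors S; rewrite Sl scale1r in Et.
have tn : size t = n.
  by have := congr1 (fun q : {poly R[i]} => size q) Et; rewrite Ss size_prod_XsubC => -[].
(* At a zero [x] of [S] with [D = |x - c| >= r] the binomial bound would read
   [D^(2n+1) <= D^(2n+1) / 4]. *)
have tr x : x \in t -> nc (x - c) < r.
  move=> xt; rewrite ltNge; apply/negP => xr.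
  have /(binomial_half_bound n) : nc (y - c) <= nc (x - c) / 8.
    by move: yr xr => ? ?; lra.
  rewrite -/S; have -> : S.[x] = 0.
    by rewrite Et horner_prod (big_rem x) //= hornerXsubC subrr mul0r.
  rewrite mulr0 subr0 modulusX.
  have : 0 < nc (x - c) ^+ (2 * n + 1) by rewrite exprn_gt0 // (lt_le_trans r0).
  by move=> ? ?; lra.
have prodt : 1 <= \prod_(x <- t) nc p.[x].
  rewrite big_seq; apply: (big_ind (fun u : R => 1 <= u)) => // [u v u1 v1|x /tr xr].
    by rewrite -[1]mulr1 ler_pM.
  by apply: Hp; exact: ltW.
(* Both sides are, up to the leading coefficient, the product over the zeros [z] of [p] of
   [|z - y|^(n+1)] and of all [|z - x|] with [x] a zero of [S]. The left side groups the factors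
   into values of [p], the right side into values of [S]. *)
have key : nc p.[y] ^+ n.+1 * \prod_(x <- t) nc p.[x] =
    \prod_(z <- s) nc ((z - y) ^+ n.+1 * S.[z]) * nc a ^+ (2 * n + 1).
  have pE x : nc p.[x] = nc a * \prod_(z <- s) nc (z - x).
    rewrite Es horner_factors modulusM modulus_prod; congr (_ * _).
    by apply: eq_bigr => z _; exact: modulus_distC.
  have SE z : nc S.[z] = \prod_(x <- t) nc (z - x).
    by rewrite Et horner_prod modulus_prod; apply: eq_bigr => x _; rewrite hornerXsubC.
  under [in LHS]eq_bigr do rewrite pE.
  rewrite big_split /= big_const_seq count_predT iter_mulr_1 tn pE exprMn.
  under [in RHS]eq_bigr do rewrite modulusM modulusX SE.
  rewrite big_split /= prodrXl exchange_big /=.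
  have -> : (2 * n + 1)%N = (n.+1 + n)%N by lia.
  by rewrite exprD; ring.
have bnd : nc p.[y] ^+ n.+1 <= (nc p.[c] ^+ 2) ^+ n.+1 * (5 / 4) ^+ size s.
  apply: (@le_trans _ _ (nc p.[y] ^+ n.+1 * \prod_(x <- t) nc p.[x])).
    by rewrite ler_peMr // exprn_ge0 ?modulus_ge0.
  rewrite key.
  apply: (@le_trans _ _ (\prod_(z <- s) (nc (z - c) ^+ (2 * n + 1) * (5 / 4)) * nc a ^+ (2 * n + 1))).
    rewrite ler_wpM2r ?exprn_ge0 ?modulus_ge0 //.
    apply: ler_prod_seq => z /sr zr; rewrite modulus_ge0 /=; apply: Sb.
    by move: yr zr => ? ?; lra.
  rewrite big_split /= big_const_seq count_predT iter_mulr_1 prodrXl mulrAC.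
  rewrite ler_wpM2r ?exprn_ge0 //.
  have -> : (\prod_(z <- s) nc (z - c)) ^+ (2 * n + 1) * nc a ^+ (2 * n + 1) = nc p.[c] ^+ (2 * n + 1).
    rewrite Es horner_factors modulusM modulus_prod -exprMn mulrC; congr ((_ * _) ^+ _).
    by apply: eq_bigr => z _; exact: modulus_distC.
  rewrite -exprM; apply: ler_weXn2l => //; lia.
rewrite expr_div_n ler_pdivrMr; first by rewrite mulrC.
by rewrite exprn_gt0.
Qed.

(* Comparison of the capacities of [{|p| <= r}] and [{|q| <= s}]: the product of
   [p(y) - v] over the zeros [y] of [q] equals, up to leading coefficients, the
   product of [q(x)] over the solutions of [p(x) = v]. *)
Lemma level_set_capacity p q r s : (1 < size p)%N -> q != 0 -> 0 < r ->
  (forall x, nc p.[x] = r -> nc q.[x] <= s) ->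
  nc (lead_coef q) ^+ (size p).-1 * r ^+ (size q).-1
    <= nc (lead_coef p) ^+ (size q).-1 * s ^+ (size p).-1.
Proof.
move=> sp q0 r0 Hpq.
have p0 : p != 0 by rewrite -size_poly_gt0 ltnW.
have [ys Eq] := poly_factors q; set b := lead_coef q in Eq *.
have b0 : b != 0 by rewrite lead_coef_eq0.
have sq : (size q).-1 = size ys by rewrite Eq size_factors.
set a := lead_coef p; have a0 : a != 0 by rewrite lead_coef_eq0.
rewrite sq; set d := (size p).-1; set e := size ys.
(* In the variable [w = 1 / v] the product of the [p(y) - v] becomes [W], up to the factor [w^e].
   The point [v] at infinity becomes [w = 0], where [|W| = 1], and the maximum principle on
   [|w| <= 1 / r] compares this with the level [|v| = r]. *)
pose W : {poly R[i]} := \prod_(y <- ys) (p.[y] *: 'X - 1).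
have WE w : W.[w] = \prod_(y <- ys) (p.[y] * w - 1).
  rewrite /W horner_prod; apply: eq_bigr => y _.
  by rewrite hornerD hornerN hornerC hornerZ hornerX.
have W0 : nc W.[0] = 1.
  rewrite WE modulus_prod big1 // => y _.
  by rewrite mulr0 sub0r modulusN modulus1.
have nb0 : 0 < nc b by rewrite modulus_gt0.
have na0 : 0 < nc a by rewrite modulus_gt0.
have := @maximum_principle _ W 0 r^-1 (nc a ^+ e * s ^+ d / (nc b ^+ d * r ^+ e)) 0.
rewrite W0 subr0 modulus0 invr_ge0 (ltW r0) ler_pdivlMr ?mul1r; last first.
  by rewrite mulr_gt0 ?exprn_gt0.
apply=> // w; rewrite subr0 => wr.
have w0 : w != 0 by rewrite -modulus_gt0 wr invr_gt0.
pose v : R[i] := w^-1.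
have vr : nc v = r by rewrite /v modulusV wr invrK.
have [xs Ex] := poly_factors (p - v%:P).
have szv : (size (v%:P : {poly R[i]}) < size p)%N.
  by apply: leq_ltn_trans sp; rewrite size_polyC leq_b1.
have lv : lead_coef (p - v%:P) = a by rewrite lead_coefDl // size_polyN.
have sv : (size (p - v%:P)).-1 = d by rewrite size_polyDl // size_polyN.
rewrite lv in Ex.
have xd : size xs = d by rewrite -sv Ex size_factors.
have xq x : x \in xs -> nc q.[x] <= s.
  move=> xx; apply: Hpq; rewrite -vr; congr nc; apply/eqP; rewrite -subr_eq0.
  have := congr1 (fun f => f.[x]) Ex; rewrite horner_factors (big_rem x) //= subrr mul0r mulr0.
  by rewrite hornerD hornerN hornerC => ->.
have pv y : nc (p.[y] - v) = nc a * \prod_(x <- xs) nc (y - x).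
  have := congr1 (fun f => f.[y]) Ex; rewrite horner_factors hornerD hornerN hornerC => ->.
  by rewrite modulusM modulus_prod.
have qx x : nc q.[x] = nc b * \prod_(y <- ys) nc (y - x).
  rewrite Eq horner_factors modulusM modulus_prod; congr (_ * _).
  by apply: eq_bigr => y _; exact: modulus_distC.
have -> : nc W.[w] = (\prod_(y <- ys) nc (p.[y] - v)) / r ^+ e.
  rewrite WE modulus_prod -exprVn /e -iter_mulr_1 -(count_predT ys) -big_const_seq -big_split /=.
  apply: eq_bigr => y _; rewrite -wr -modulusM; congr nc.
  by rewrite mulrBl /v mulVf.
rewrite invfM mulrA ler_wpM2r ?invr_ge0 ?exprn_ge0 ?(ltW r0) //.
rewrite ler_pdivlMr ?exprn_gt0 //.
have -> : \prod_(y <- ys) nc (p.[y] - v) * nc b ^+ d = nc a ^+ e * \prod_(x <- xs) nc q.[x].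
  under [in LHS]eq_bigr do rewrite pv.
  under [in RHS]eq_bigr do rewrite qx.
  rewrite !big_split /= !big_const_seq !count_predT !iter_mulr_1 xd exchange_big /=.
  by rewrite mulrAC mulrA.
rewrite ler_wpM2l ?exprn_ge0 ?modulus_ge0 //.
apply: (@le_trans _ _ (\prod_(x <- xs) s)).
  by apply: ler_prod_seq => x /xq ->; rewrite modulus_ge0.
by rewrite big_const_seq count_predT iter_mulr_1 xd.
Qed.

End HarnackCapacity.

(** * Connectedness of level sets *)

Section Topology.
Context {R : realType}.
Local Notation C := (cplx R).
Local Notation nc := (@Normc.normc R).
Implicit Types (z w c x y : C) (p q g : {poly R[i]}) (r e t : R).

Lemma closed_disconnect (T : topologicalType) (E : set T) : closed E -> ~ connected E ->
  exists A B : set T, [/\ closed A, closed B, A !=set0, B !=set0 &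
    E = A `|` B /\ A `&` B = set0].
Proof.
move=> cE /connectedPn [S [S0 ES [S1 S2]]].
have sub b : closure (S b) `<=` E.
  by rewrite (closure_id E).1 //; apply: closureS; rewrite ES; case: b => x; [right|left].
exists (S false), (S true); split=> //; last first.
- by split=> //; apply: separated_disjoint; split.
- move=> x /[dup] xS /sub; rewrite ES => -[] // xf.
  by exfalso; have : (S false `&` closure (S true)) x by []; rewrite S2.
- move=> x /[dup] xS /sub; rewrite ES => -[] // xf.
  by exfalso; have : (closure (S false) `&` S true) x by []; rewrite S1.
Qed.

Lemma connected_disjoint_open (T : topologicalType) (A B K : set T) :
  open A -> open B -> A `&` B = set0 -> K `<=` A `|` B -> connected K ->
  K `<=` A \/ K `<=` B.
Proof.
move=> oA oB AB KAB cK.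
have sep (X Y : set T) : open Y -> X `&` Y = set0 -> closure X `&` Y = set0.
  move=> oY XY; rewrite -subset0 => x [xX xY].
  have [y [Xy Yy]] := xX _ (open_nbhs_nbhs (conj oY xY)).
  by have : (X `&` Y) y by []; rewrite XY.
apply: connected_subset cK => //; split; first exact: sep.
by rewrite setIC; apply: sep => //; rewrite setIC.
Qed.

Lemma connected_disjoint_closed (T : topologicalType) (A B K : set T) :
  closed A -> closed B -> A `&` B = set0 -> K `<=` A `|` B -> connected K ->
  K `<=` A \/ K `<=` B.
Proof.
move=> cA cB AB KAB cK; apply: connected_subset cK => //.
by split; rewrite -(closure_id _).1.
Qed.

Lemma closed_separation (A B : set C) : closed A -> closed B -> A `&` B = set0 ->
  exists U V : set C, [/\ open U, open V, A `<=` U, B `<=` V & U `&` V = set0].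
Proof.
move=> cA cB AB.
(* Discs of radius [d] about points of [X] at distance at least [2 d] from [Y]. Such discs of radii
   [d] and [d'] on opposite sides are disjoint, because their centers are at least [d + d']
   apart. *)
pose nbd (X Y : set C) : set C := [set x | exists a d, [/\ X a, 0 < d, nc (x - a) < d &
  forall b, Y b -> 2 * d <= nc (a - b)]].
have onbd X Y : open (nbd X Y).
  rewrite openE => x [a [d [Xa d0 xa H]]]; apply/nbhs_modulusP.
  exists (d - nc (x - a)); first by rewrite subr_gt0.
  move=> w wx; exists a, d; split=> //.
  by have := modulus_triangle w x a; move: wx => ? ?; lra.
have subn (X Y : set C) : closed Y -> X `&` Y = set0 -> X `<=` nbd X Y.
  move=> cY XY a Xa.
  have : (~` Y) a by move=> Ya; have : (X `&` Y) a by []; rewrite XY.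
  have oY : open (~` Y) by exact: closed_openC.
  move=> aY; have /nbhs_modulusP[e e0 He] := open_nbhs_nbhs (conj oY aY).
  exists a, (e / 2); split=> //; first by rewrite divr_gt0.
    by rewrite subrr modulus0 divr_gt0.
  move=> b Yb; rewrite leNgt; apply/negP => be; apply: (He b) => //.
  by rewrite modulus_distC; move: be => ?; lra.
exists (nbd A B), (nbd B A); split=> //.
- exact: subn.
- by apply: subn => //; rewrite setIC.
clear AB; rewrite -subset0 => x [[a [d [Aa d0 xa HA]]] [b [d' [Bb d0' xb HB]]]].
have := HA _ Bb; have := HB _ Aa; rewrite (modulus_distC b a).
have := modulus_triangle a x b; rewrite (modulus_distC a x).
by move: xa xb => ? ? ? ? ?; lra.
Qed.

Lemma horner_growth p (B : R) : (1 < size p)%N ->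
  exists r : R, forall z, r <= nc z -> B < nc p.[z].
Proof.
elim/poly_ind: p B => [|p c IH] B; first by rewrite size_poly0.
have [sp|sp] := leqP (size p) 1.
  rewrite (size1_polyC sp); set a := p`_0 => H.
  have a0 : a != 0.
    by apply: contraTneq H => ->; rewrite polyC0 mul0r add0r size_polyC -leqNgt leq_b1.
  have na : 0 < nc a by rewrite modulus_gt0.
  exists ((B + nc c + 1) / nc a) => z; rewrite ler_pdivrMr // => Hz.
  rewrite hornerMXaddC hornerC; have := modulusD_ge (a * z) c.
  by rewrite modulusM mulrC; move: Hz => ? ?; lra.
move=> _; have [r Hr] := IH 1 sp.
exists (Num.max r (`|B| + nc c + 1)) => z; rewrite ge_max => /andP[/Hr pz zB].
rewrite hornerMXaddC; have := modulusD_ge (p.[z] * z) c; rewrite modulusM.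
have : nc z <= nc p.[z] * nc z by rewrite ler_peMl ?modulus_ge0 // ltW.
by have := ler_norm B; move: zB => ? ? ? ?; lra.
Qed.

Lemma compact_sublevel p r : (1 < size p)%N -> compact [set z : C | nc p.[z] <= r].
Proof.
move=> sp; have [B HB] := horner_growth r sp.
apply: (@compact_bounded_closed _ B).
  exact/closed_sublevel/modulus_horner_continuous.
by move=> z /= zr; rewrite leNgt; apply/negP => /ltW /HB; rewrite ltNge zr.
Qed.

(** One constant serves all base points near [x]: the direction of descent is fixed at [x] and then
    used at every nearby point. *)
Lemma horner_taylor2 p x : exists2 K, 0 <= K & forall z h, nc (z - x) <= 1 -> nc h <= 1 ->
  nc (p.[z + h] - p.[z] - h * p^`().[z]) <= K * nc h ^+ 2.
Proof.
elim/poly_ind: p => [|p c [K K0 IH]].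
  by exists 0 => // z h _ _; rewrite deriv0 !horner0 mulr0 !subr0 modulus0 mul0r.
have [L L0 HL] := horner_local_lipschitz p^`() x.
exists (K * (nc x + 2) + (nc p^`().[x] + L)) => [|z h zx h1].
  by rewrite !addr_ge0 ?mulr_ge0 ?addr_ge0 ?modulus_ge0.
have -> : (p * 'X + c%:P)^`().[z] = p^`().[z] * z + p.[z].
  by rewrite derivMXaddC hornerD hornerM hornerX addrC.
rewrite !hornerMXaddC.
have -> : p.[z + h] * (z + h) + c - (p.[z] * z + c) - h * (p^`().[z] * z + p.[z]) =
  (p.[z + h] - p.[z] - h * p^`().[z]) * (z + h) + h ^+ 2 * p^`().[z] by ring.
rewrite [leRHS]mulrDl; apply: (le_trans (modulusD _ _)); apply: lerD; rewrite modulusM.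
  rewrite -mulrA [(_ + 2) * _]mulrC mulrA; apply: ler_pM; rewrite ?modulus_ge0 ?IH //.
  have := modulusD (z - x) x; rewrite subrK; have := modulusD z h.
  by move: zx h1 => ? ? ? ?; lra.
rewrite modulusX mulrC ler_wpM2r ?exprn_ge0 ?modulus_ge0 //.
have := modulusD (p^`().[z] - p^`().[x]) p^`().[x]; rewrite subrK.
have : L * nc (z - x) <= L by rewrite ler_piMr.
by have := HL z zx; move=> ? ? ?; lra.
Qed.

(* [u] is Newton's direction [- g(x) / g'(x)]. *)
Lemma descent_direction g x : g.[x] != 0 -> g^`().[x] != 0 ->
  exists (u : C) (d h : R), [/\ 0 < d, 0 < h &
    forall z s, nc (z - x) < d -> 0 <= s <= h ->
      nc g.[z + (s%:C)%C * u] <= nc g.[z] - s * (nc g.[x] / 4)].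
Proof.
move=> gx0 g'x0; pose u : C := - (g.[x] / g^`().[x]).
set t := nc g.[x]; have t0 : 0 < t by rewrite modulus_gt0.
have g'0 : 0 < nc g^`().[x] by rewrite modulus_gt0.
have [K K0 HK] := horner_taylor2 g x.
have [|d1 d10 H1] := @horner_continuity R g x (t / 16); first by rewrite divr_gt0.
have [|d2 d20 H2] := @horner_continuity R g^`() x (nc g^`().[x] / 16).
  by rewrite divr_gt0.
have u1 : 0 < nc u + 1 by rewrite ltr_wpDl ?modulus_ge0.
have K1 : 0 < (K + 1) * (nc u + 1) ^+ 2 by rewrite mulr_gt0 ?exprn_gt0 // ltr_wpDl.
exists u, (Num.min 1 (Num.min d1 d2)),
  (Num.min 1 (Num.min (nc u + 1)^-1 (t / 8 / ((K + 1) * (nc u + 1) ^+ 2)))).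
split; first by rewrite !lt_min ltr01 d10.
  by rewrite !lt_min ltr01 invr_gt0 u1 !divr_gt0.
move=> z s; rewrite !lt_min !le_min => /and3P[zx /H1 /= gz /H2 /= g'z] /andP[s0 /and3P[s1 su sK]].
have su1 : nc ((s%:C)%C * u) <= 1.
  rewrite modulusM modulus_real ger0_norm //.
  have : s * (nc u + 1) <= 1 by rewrite -ler_pdivlMr // mul1r.
  by move=> ?; have := modulus_ge0 u; nra.
have := HK z _ (ltW zx) su1; rewrite modulusM modulus_real ger0_norm //.
set rem := _ - _ => Hrem.
have Hrem' : nc rem <= s * (t / 8).
  apply: (le_trans Hrem).
  have : s * ((K + 1) * (nc u + 1) ^+ 2) <= t / 8 by rewrite -ler_pdivlMr.
  move=> H; have -> : K * (s * nc u) ^+ 2 = s * (s * (K * nc u ^+ 2)) by ring.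
  rewrite ler_wpM2l //; apply: le_trans H; rewrite ler_wpM2l //.
  rewrite ler_pM ?exprn_ge0 ?modulus_ge0 ?lerDl //.
  by rewrite lerXn2r ?nnegrE ?modulus_ge0 ?lerDl // ltW.
have Hlin : nc (u * g^`().[z] + g.[z]) <= t / 8.
  have -> : u * g^`().[z] + g.[z] =
    (g.[z] - g.[x]) - (g.[x] / g^`().[x]) * (g^`().[z] - g^`().[x]).
    by rewrite /u; field.
  apply: (le_trans (modulusB _ _)); rewrite !modulusM modulusV -/t.
  have : t / nc g^`().[x] * nc (g^`().[z] - g^`().[x]) <= t / 16.
    rewrite -mulrA ler_wpM2l ?(ltW t0) // mulrC ler_pdivrMr //.
    by rewrite mulrC; exact: ltW.
  by move: gz => ? ?; lra.
have gzt : t / 2 <= nc g.[z].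
  by have := modulusB_ge g.[x] g.[z]; rewrite (modulus_distC g.[x]) -/t; move: gz => ? ?; lra.
(* The step along [s u] turns [g(z)] into [(1 - s) g(z)] plus two errors of modulus at most
   [s t / 8]. As [|g(z)| >= t / 2], the net loss is at least [s t / 4]. *)
have -> : g.[z + (s%:C)%C * u] = ((1 - s)%:C)%C * g.[z] + (s%:C)%C * (u * g^`().[z] + g.[z]) + rem.
  by rewrite /rem rmorphB rmorph1; ring.
apply: (le_trans (modulusD _ _)).
have := modulusD (((1 - s)%:C)%C * g.[z]) ((s%:C)%C * (u * g^`().[z] + g.[z])).
rewrite !modulusM !modulus_real !ger0_norm // ?subr_ge0 // => H.
have : s * nc (u * g^`().[z] + g.[z]) <= s * (t / 8) by rewrite ler_wpM2l.
have : s * (t / 2) <= s * nc g.[z] by rewrite ler_wpM2l.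
by move: H Hrem' => ? ? ? ?; lra.
Qed.

Lemma connected_component_monotone (T : topologicalType) (A B : set T) (x y : T) :
  A `<=` B -> connected_component A x y -> connected_component B x y.
Proof. by move=> AB [D [Dx DA cD] Dy]; exists D => //; split=> //; apply: subset_trans AB. Qed.

End Topology.

(** * Connectedness of sublevel sets above the critical values *)

Section LevelSets.
Context {R : realType}.
Local Notation C := (cplx R).
Local Notation nc := (@Normc.normc R).
Implicit Types (z w c x y : C) (p q g : {poly R[i]}) (r e t : R).

(** The minimum of [|g|] over the compact part of [{|g| <= t + 1}] outside [U] exceeds [t]. *)
Lemma compact_sublevel_thicken g t (U : set C) : (1 < size g)%N -> open U ->
  [set z | nc g.[z] <= t] `<=` U ->
  exists2 e : R, 0 < e & [set z | nc g.[z] <= t + e] `<=` U.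
Proof.
move=> sg oU LU.
pose K := [set z : C | nc g.[z] <= t + 1] `&` ~` U.
have cK : compact K.
  by apply: compact_closedI; [exact: compact_sublevel|exact: open_closedC].
have [K0|/set0P K0] := eqVneq K set0.
  exists 1 => // z Hz; apply: contrapT => Uz.
  by have : K z by []; rewrite K0.
have [|m mK mP] := @compact_EVT_min _ R (fun z => nc g.[z]) K K0 cK.
  exact/continuous_subspaceT/modulus_horner_continuous.
move: mK; rewrite inE => -[m1 mU].
have mt : t < nc g.[m] by rewrite ltNge; apply/negP => /LU.
exists (Num.min 1 ((nc g.[m] - t) / 2)).
  by rewrite lt_min ltr01 divr_gt0 // subr_gt0.
move=> z /= Hz; apply: contrapT => Uz.
have Hz1 : nc g.[z] <= t + 1 by apply: le_trans Hz _; rewrite lerD2l ge_min lexx.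
have Hz2 : nc g.[z] <= t + (nc g.[m] - t) / 2.
  by apply: le_trans Hz _; rewrite lerD2l ge_min lexx orbT.
have : nc g.[m] <= nc g.[z] by apply: mP; rewrite inE.
by move: mt Hz2 => ? ? ?; lra.
Qed.

(** With [t = |g(x)|], three segments join [y] to [z]: both points are pushed by the same vector
    [v], along which [|g|] does not rise above its initial value, and the translated segment lies
    where [|g| <= t - h t / 8]. The level found is strictly below [|g(x)|] because
    [sublevel_component_strict] approaches the supremum of the separating levels from below. *)
Lemma noncritical_local_sublevel g x : g.[x] != 0 -> g^`().[x] != 0 ->
  exists2 d, 0 < d & forall y z, nc (y - x) < d -> nc (z - x) < d ->
    nc g.[y] < nc g.[x] -> nc g.[z] < nc g.[x] ->
    exists2 t, t < nc g.[x] & connected_component [set w : C | nc g.[w] <= t] y z.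
Proof.
move=> gx0 g'x0; have [u [d1 [h [d10 h0 Hdes]]]] := descent_direction gx0 g'x0.
set t := nc g.[x] in Hdes *; have t0 : 0 < t by rewrite modulus_gt0.
have [|d2 d20 Hd2] := @horner_continuity R g x (h * (t / 8)).
  by rewrite mulr_gt0 // divr_gt0.
pose v : C := (h%:C)%C * u.
have in_ball w : nc (w - x) < Num.min d1 d2 -> nc g.[w + v] <= t - h * (t / 8).
  rewrite lt_min => /andP[w1 /Hd2 w2].
  have := Hdes w h w1; rewrite lexx (ltW h0) => /(_ isT).
  by have := modulusB_ge g.[w] g.[x]; rewrite -/t -/v; move: w2 => ? ? ?; lra.
have down w s : nc (w - x) < Num.min d1 d2 -> 0 <= s <= 1 ->
    nc g.[w + (s%:C)%C * v] <= nc g.[w].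
  rewrite lt_min => /andP[w1 _] /andP[s0 s1].
  have := Hdes w (s * h) w1; rewrite mulr_ge0 ?(ltW h0) // ler_piMl ?(ltW h0) // => /(_ isT).
  have -> : ((s * h)%:C)%C * u = (s%:C)%C * v by rewrite /v rmorphM mulrA.
  move=> /le_trans; apply; rewrite gerBl.
  by rewrite !mulr_ge0 ?invr_ge0 ?(ltW h0) ?(ltW t0).
exists (Num.min d1 d2); first by rewrite lt_min d10.
move=> y z yd zd yt zt.
exists (Num.max (t - h * (t / 8)) (Num.max (nc g.[y]) (nc g.[z]))).
  by rewrite !gt_max yt zt !andbT gtrBl mulr_gt0 // divr_gt0.
set L := [set w : C | _].
have vert w : nc (w - x) < Num.min d1 d2 ->
    nc g.[w] <= Num.max (nc g.[y]) (nc g.[z]) -> connected_component L w (w + v).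
  move=> wd wt; exists (segment w (w + v)); last exact: segment_right.
  split; [exact: segment_left| |exact: segment_connected_cplx].
  move=> _ [s /= + <-]; rewrite in_itv /= => s01.
  rewrite /L /= /segment_path [w + v - w]addrC addKr le_max.
  by rewrite (le_trans (down _ _ wd s01) wt) orbT.
apply: (connected_component_trans (y := y + v)).
  by apply: vert => //; rewrite le_max lexx.
apply: (connected_component_trans (y := z + v)); last first.
  by apply/connected_component_sym/vert => //; rewrite le_max lexx orbT.
exists (segment (y + v) (z + v)); last exact: segment_right.
split; [exact: segment_left| |exact: segment_connected_cplx].
move=> _ [s /= + <-]; rewrite in_itv /= => /andP[s0 s1].
have -> : segment_path (y + v) (z + v) s = segment_path y z s + v.
  by rewrite /segment_path; ring.
rewrite /L /= le_max in_ball //.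
have E : segment_path y z s - x = ((1 - s)%:C)%C * (y - x) + (s%:C)%C * (z - x).
  by rewrite /segment_path rmorphB rmorph1; ring.
rewrite E; apply: (le_lt_trans (modulusD _ _)); rewrite !modulusM !modulus_real !ger0_norm ?subr_ge0 //.
have [->|sn0] := eqVneq s 0; first by rewrite subr0 mul1r mul0r addr0.
have sp : 0 < s by rewrite lt_neqAle eq_sym sn0.
by move: (Num.min d1 d2) yd zd => D yd zd; nra.
Qed.

Lemma noncritical_sublevel_closure g x e : g.[x] != 0 -> g^`().[x] != 0 -> 0 < e ->
  exists z, [/\ nc (z - x) < e, nc g.[z] < nc g.[x] &
    connected_component [set w : C | nc g.[w] <= nc g.[x]] x z].
Proof.
move=> gx0 g'x0 e0; have [u [d [h [d0 h0 Hdes]]]] := descent_direction gx0 g'x0.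
have t0 : 0 < nc g.[x] by rewrite modulus_gt0.
have u1 : 0 < nc u + 1 by rewrite ltr_wpDl ?modulus_ge0.
pose s := Num.min h (e / (nc u + 1)).
have s0 : 0 < s by rewrite lt_min h0 divr_gt0.
have sh : s <= h by rewrite ge_min lexx.
have se : s * (nc u + 1) <= e by rewrite -ler_pdivlMr // ge_min lexx orbT.
have xx : nc (x - x) < d by rewrite subrr modulus0.
exists (x + (s%:C)%C * u); split.
- rewrite addrC addKr modulusM modulus_real gtr0_norm //.
  by move: se => ?; nra.
- have := Hdes x s xx; rewrite (ltW s0) sh => /(_ isT) /le_lt_trans; apply.
  by rewrite gtrBl mulr_gt0 // divr_gt0.
exists (segment x (x + (s%:C)%C * u)); last exact: segment_right.
split; [exact: segment_left| |exact: segment_connected_cplx].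
move=> _ [a /= + <-]; rewrite in_itv /= => /andP[a0 a1].
rewrite /= /segment_path [x + _ - x]addrC addKr.
have := Hdes x (a * s) xx; rewrite mulr_ge0 ?(ltW s0) //.
have -> : a * s <= h by apply: le_trans sh; rewrite ler_piMl // ltW.
move=> /(_ isT); rewrite rmorphM mulrA => /le_trans; apply.
by rewrite gerBl mulr_ge0 // ?divr_ge0 ?mulr_ge0 // ltW.
Qed.

(* Suppose two points of [{|g| < r}] are in different components of
   [{|g| <= r}], and let [t] be the supremum of the levels at which they stay in
   different components. At the level [t] the components of [{|g| < t}] can only
   touch at a critical point, so the two points can still be separated slightly
   above [t]. *)
Lemma sublevel_component_strict g r x y : (1 < size g)%N -> 0 < r ->
  (forall c, g^`().[c] = 0 -> nc g.[c] < r) ->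
  nc g.[x] < r -> nc g.[y] < r ->
  connected_component [set z : C | nc g.[z] <= r] x y.
Proof.
move=> sg r0 Hcrit xr yr; apply: contrapT => nxy.
pose L t := [set z : C | nc g.[z] <= t].
have L_mono s t : s <= t -> L s `<=` L t by move=> st z /le_trans; apply.
pose T := [set t : R | r <= t /\ ~ connected_component (L t) x y].
have [B TB] : exists B, ubound T B.
  have [|m _ mP] := compact_modulus_max g (@compact_disc R 0 (Num.max (nc x) (nc y))).
    by exists x; rewrite /= subr0 le_max lexx.
  exists (nc g.[m]) => t [_ nt]; rewrite leNgt; apply/negP => mt; apply: nt.
  exists [set z : C | nc (z - 0) <= Num.max (nc x) (nc y)]; last first.
    by rewrite /= subr0 le_max lexx orbT.
  split; first by rewrite /= subr0 le_max lexx.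
    by move=> z /mP /le_trans; apply; exact: ltW.
  by apply: disc_connected; rewrite le_max modulus_ge0.
have Tr : T r by split.
have supT : has_sup T by split; [exists r|exists B].
set t := sup T.
have rt : r <= t by apply: sup_upper_bound.
have below s : s < t -> ~ connected_component (L s) x y.
  move=> st; have ts0 : 0 < t - s by rewrite subr_gt0.
  have [s' [rs' ns'] ss'] := sup_adherent ts0 supT.
  move=> /connected_component_monotone; move/(_ (L s')) => H; apply/ns'/H.
  by apply: L_mono; move: ss'; rewrite -/t => ?; lra.
pose W := [set z : C | exists2 s, s < t & connected_component (L s) x z].
(* Near [z] the set [{|g| < t}] lies in [W] or misses it. Points at level [t] are noncritical, as
   critical values are below [r <= t]; about a lower point a small disc lies below the level
   [s' < t]. *)
have local_W z : nc g.[z] <= t -> exists2 d, 0 < d & exists P : Prop,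
    forall w, nc (w - z) < d -> nc g.[w] < t -> W w <-> P.
  rewrite le_eqVlt => /orP[/eqP gz|gz].
    have gz0 : g.[z] != 0 by rewrite -modulus_gt0 gz (lt_le_trans r0).
    have g'z0 : g^`().[z] != 0.
      by apply/eqP => /Hcrit; rewrite gz ltNge rt.
    have [d d0 Hd] := noncritical_local_sublevel gz0 g'z0; rewrite gz in Hd.
    exists d => //; exists (exists2 w, nc (w - z) < d & nc g.[w] < t /\ W w).
    move=> w wd wt; split=> [Ww|[w' wd' [wt' [s st Hs]]]]; first by exists w.
    have [s' st' Hs'] := Hd _ _ wd' wd wt' wt.
    exists (Num.max s s'); first by rewrite gt_max st.
    apply: connected_component_trans.
      by apply: connected_component_monotone Hs; apply: L_mono; rewrite le_max lexx.
    by apply: connected_component_monotone Hs'; apply: L_mono; rewrite le_max lexx orbT.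
  have tz : 0 < (t - nc g.[z]) / 2 by rewrite divr_gt0 // subr_gt0.
  have [d d0 Hd] := @horner_continuity R g z _ tz.
  pose s' := (t + nc g.[z]) / 2.
  have s't : s' < t by rewrite /s'; move: gz => ?; lra.
  have ball_L w : nc (w - z) < d -> connected_component (L s') z w.
    move=> wd; exists [set w : C | nc (w - z) < d] => //; split.
    - by rewrite /= subrr modulus0.
    - move=> w' /Hd; have := modulusB_ge g.[w'] g.[z]; rewrite /L /= /s' => ? ?; lra.
    - exact: open_disc_connected.
  exists d => //; exists (W z) => w /ball_L Hw _; split=> -[s st Hs]; exists (Num.max s s');
    rewrite ?gt_max ?st ?s't //.
    apply: connected_component_trans.
      by apply: connected_component_monotone Hs; apply: L_mono; rewrite le_max lexx.
    apply: connected_component_monotone (connected_component_sym Hw).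
    by apply: L_mono; rewrite le_max lexx orbT.
  apply: connected_component_trans.
    by apply: connected_component_monotone Hs; apply: L_mono; rewrite le_max lexx.
  by apply: connected_component_monotone Hw; apply: L_mono; rewrite le_max lexx orbT.
have dense z d : nc g.[z] <= t -> 0 < d -> exists2 w, nc (w - z) < d & nc g.[w] < t.
  rewrite le_eqVlt => /orP[/eqP gz|gz] d0; last first.
    by exists z => //; rewrite subrr modulus0.
  have gz0 : g.[z] != 0 by rewrite -modulus_gt0 gz (lt_le_trans r0).
  have g'z0 : g^`().[z] != 0 by apply/eqP => /Hcrit; rewrite gz ltNge rt.
  have [w [wd wt _]] := noncritical_sublevel_closure gz0 g'z0 d0.
  by exists w => //; rewrite -gz.
(* The two sets split [L t] according to whether the nearby part of [{|g| < t}] belongs to [W]. Both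
   are open, so their traces on [L t] are closed and can be separated by open sets; these still
   contain [L (t + e)], which contradicts the supremum. *)
pose V (b : bool) := [set z : C | exists2 d, 0 < d &
  forall w, nc (w - z) < d -> nc g.[w] < t -> if b then W w else ~ W w].
have oV b : open (V b).
  rewrite openE => z [d d0 Hd]; apply/nbhs_modulusP.
  exists (d / 2); first by rewrite divr_gt0.
  move=> z' z'z; exists (d / 2); first by rewrite divr_gt0.
  move=> w wz'; apply: Hd; have := modulus_triangle w z' z.
  by move: wz' z'z => ? ? ?; lra.
have VL z : L t z -> V true z \/ V false z.
  move=> /local_W [d d0 [P HP]]; have [p|np] := pselect P.
    by left; exists d => // w wd wt; apply/(HP w wd wt).
  by right; exists d => // w wd wt /(HP w wd wt).
have VV z : L t z -> V true z -> V false z -> False.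
  move=> Lz [d d0 Hd] [d' d'0 Hd'].
  have [|w] := dense z (Num.min d d') Lz; first by rewrite lt_min d0.
  by rewrite lt_min => /andP[wd wd'] wt; apply: (Hd' w wd' wt); exact: Hd.
have cL : closed (L t) by exact/closed_sublevel/modulus_horner_continuous.
have cA b : closed (L t `&` ~` V b) by apply: closedI => //; exact: open_closedC.
have AB : (L t `&` ~` V true) `&` (L t `&` ~` V false) = set0.
  by rewrite -subset0 => z [[/VL]] [|] Vz nVz [_].
have [U1 [U2 [oU1 oU2 AU1 AU2 U12]]] := closed_separation (cA true) (cA false) AB.
have LU : L t `<=` U1 `|` U2.
  move=> z Lz; have [V1|V1] := pselect (V true z); last by left; apply: AU1.
  by right; apply: AU2; split=> // V2; exact: (VV z).
have [e e0 He] := compact_sublevel_thicken sg (openU oU1 oU2) LU.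
have xt : nc g.[x] < t := lt_le_trans xr rt.
have yt : nc g.[y] < t := lt_le_trans yr rt.
have Wx : W x by exists (nc g.[x]) => //; apply: connected_component_refl; rewrite /L /=.
have Wy : ~ W y by move=> [s /below].
have Ux : U2 x.
  apply: AU2; split; first exact: ltW.
  by move=> [d d0 /(_ x)]; rewrite subrr modulus0 => /(_ d0 xt).
have Uy : U1 y.
  apply: AU1; split; first exact: ltW.
  by move=> [d d0 /(_ y)]; rewrite subrr modulus0 => /(_ d0 yt).
suff : T (t + e) by move=> /(sup_upper_bound supT); rewrite -/t gerDl leNgt e0.
split; first by rewrite (le_trans rt) // lerDl ltW.
move=> [D [Dx DL cD] Dy].
have [DU|DU] := connected_disjoint_open oU1 oU2 U12 (subset_trans DL He) cD.
- have : (U1 `&` U2) x by split=> //; exact: DU.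
  by rewrite U12.
- have : (U1 `&` U2) y by split=> //; exact: DU.
  by rewrite U12.
Qed.

Lemma sublevel_connected g r : (1 < size g)%N -> 0 < r ->
  (forall c, g^`().[c] = 0 -> nc g.[c] < r) ->
  connected [set z : C | nc g.[z] <= r].
Proof.
move=> sg r0 Hcrit; set L := [set z : C | _].
have toint x : L x -> exists2 z, nc g.[z] < r & connected_component L x z.
  rewrite /L /= le_eqVlt => /orP[/eqP gx|gx]; last first.
    by exists x => //; apply: connected_component_refl; exact: ltW.
  have gx0 : g.[x] != 0 by rewrite -modulus_gt0 gx.
  have g'x0 : g^`().[x] != 0 by apply/eqP => /Hcrit; rewrite gx ltxx.
  have [z [_ zr Hz]] := noncritical_sublevel_closure gx0 g'x0 ltr01.
  by rewrite gx in zr Hz; exists z.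
have [L0|/set0P[x Lx]] := eqVneq L set0; first by rewrite L0; exact: connected0.
rewrite (_ : L = connected_component L x); first exact: component_connected.
apply/seteqP; split; last exact: connected_component_sub.
move=> y /toint [y' y'r /connected_component_sym Hy].
have [x' x'r Hx] := toint _ Lx.
apply: connected_component_trans Hx _; apply: connected_component_trans Hy.
exact: sublevel_component_strict.
Qed.

End LevelSets.

(** * Continuous angles and unicoherence of the plane *)

Section Unicoherence.
Context {R : realType}.
Local Notation C := (cplx R).
Local Notation nc := (@Normc.normc R).
Implicit Types (z w c x y : C) (p q g : {poly R[i]}) (r e t : R).

Lemma unit_path_surj z : nc z = 1 -> exists t, z = unit_path t.
Proof.
case: z => a b /= /(congr1 (fun u => u ^+ 2)); rewrite expr1n sqr_sqrtr ?addr_ge0 ?sqr_ge0 // => ab.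
have a1 : -1 <= a <= 1 by apply/andP; split; nra.
have [ca sa] : cos (acos a) = a /\ sin (acos a) = `|b|.
  split; first by rewrite acosK // in_itv.
  by rewrite sin_acos // -sqrtr_sqr; congr Num.sqrt; rewrite -ab; ring.
have [b0|b0] := lerP 0 b.
  by exists (acos a); rewrite /unit_path ca sa ger0_norm.
by exists (- acos a); rewrite /unit_path cosN sinN ca sa ltr0_norm // opprK.
Qed.

Lemma circle_connected r : 0 < r -> connected [set z : C | nc z = r].
Proof.
move=> r0; rewrite (_ : [set z : C | _] = (fun t => (r%:C)%C * unit_path t : C) @` [set: R]).
  apply: connected_continuous_connected; first exact/connected_intervalP.
  apply: continuous_subspaceT => t A /nbhs_modulusP[e e0 He].
  have er : 0 < e / r by rewrite divr_gt0.
  have := @unit_path_continuous R t _ (nbhs_modulus (unit_path t) er).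
  rewrite !nbhs_simpl /=; apply: filterS => s /= Hs.
  apply: He; rewrite -mulrBr modulusM modulus_real gtr0_norm //.
  by rewrite mulrC -ltr_pdivlMr.
apply/seteqP; split=> [z /= zr|_ [t _ <-]]; last first.
  change (nc ((r%:C)%C * unit_path t) = r).
  by rewrite modulusM modulus_real modulus_unit_path mulr1 gtr0_norm.
have rn0 : (r%:C)%C != 0 :> R[i] by rewrite -modulus_gt0 modulus_real normr_gt0 gt_eqF.
have [|t Et] := @unit_path_surj (z / (r%:C)%C).
  by rewrite modulusM modulusV modulus_real zr gtr0_norm // divff // gt_eqF.
by exists t => //; rewrite -Et mulrC divfK.
Qed.

(** A piece not meeting the outer circle would be compact, and its point of largest [|g|] would be a
    local maximum of [|g|] in the plane. *)
Lemma superlevel_in_disc_connected g r s : (1 < size g)%N -> 0 < s ->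
  (forall z, nc g.[z] <= r -> nc z < s) ->
  connected ([set z : C | r <= nc g.[z]] `&` [set z | nc z <= s]).
Proof.
move=> sg s0 Hs; set E := _ `&` _.
have cd : closed [set z : C | nc z <= s] by exact/closed_sublevel/modulus_continuous.
have cE : closed E.
  by apply: closedI => //; exact/closed_superlevel/modulus_horner_continuous.
have circE : [set z : C | nc z = s] `<=` E.
  move=> z /= zs; split; last by rewrite /= zs.
  by rewrite /= leNgt; apply/negP => /ltW /Hs; rewrite zs ltxx.
apply: contrapT => /(closed_disconnect cE) [A [B [cA cB A0 B0 [EAB AB]]]].
wlog circA : A B cA cB A0 B0 EAB AB / [set z : C | nc z = s] `<=` A.
  move=> W; have : [set z : C | nc z = s] `<=` A `|` B by rewrite -EAB.
  case/(connected_disjoint_closed cA cB AB)/(_ (circle_connected s0)) => H.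
    exact: (W A B).
  by apply: (W B A) => //; [rewrite EAB setUC|rewrite -AB setIC].
have compB : compact B.
  apply: (@compact_bounded_closed _ s) => // z Bz.
  by have [] : E z by rewrite EAB; right.
have [m Bm Hm] := compact_modulus_max g compB B0.
have Em : E m by rewrite EAB; right.
have ms : nc m < s.
  rewrite lt_neqAle Em.2 andbT; apply/eqP => /circA Am.
  by have := conj Am Bm : (A `&` B) m; rewrite AB.
have nAm : ~ A m by move=> Am; have := conj Am Bm : (A `&` B) m; rewrite AB.
have /nbhs_modulusP[d d0 Hd] := open_nbhs_nbhs (conj (closed_openC cA) nAm).
have e0 : 0 < Num.min d (s - nc m) by rewrite lt_min d0 subr_gt0.
have [w] := modulus_horner_no_local_max m sg e0.
rewrite lt_min => /andP[wd ws] gmw.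
have /Hm : B w.
  have : E w.
    split; first by rewrite /= (le_trans Em.1) // ltW.
    by rewrite /=; have := modulusD (w - m) m; rewrite subrK; move: ws => ? ?; lra.
  by rewrite EAB => -[/(Hd _ wd)|].
by rewrite leNgt gmw.
Qed.

(** The imaginary part of [w] times the conjugate of [v]: for unit vectors, the sine of the angle
    from [v] to [w]. *)
Definition cross (w v : R[i]) : R :=
  complex.Im w * complex.Re v - complex.Re w * complex.Im v.

(** [|w - v| < 1] makes the cosine of the angle positive, so [asin] recovers the angle from its
    sine, and continuously since the sine stays off -1 and 1. *)
Lemma cross_small (w v : R[i]) : nc w = 1 -> nc v = 1 -> nc (w - v) < 1 ->
  -1 < cross w v < 1 /\ w = unit_path (asin (cross w v)) * v.
Proof.
case: w => a b; case: v => c d; rewrite /cross /= => /(congr1 (fun u => u ^+ 2)).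
rewrite expr1n sqr_sqrtr ?addr_ge0 ?sqr_ge0 // => ab /(congr1 (fun u => u ^+ 2)).
rewrite expr1n sqr_sqrtr ?addr_ge0 ?sqr_ge0 // => cd H.
have {}H : (a - c) ^+ 2 + (b - d) ^+ 2 < 1.
  rewrite -[ltLHS]sqr_sqrtr ?addr_ge0 ?sqr_ge0 // expr_lt1 // ?sqrtr_ge0 //.
have pos : 0 < a * c + b * d by nra.
have E : 1 - (b * c - a * d) ^+ 2 = (a * c + b * d) ^+ 2.
  have -> : 1 - (b * c - a * d) ^+ 2 = (a ^+ 2 + b ^+ 2) * (c ^+ 2 + d ^+ 2) - (b * c - a * d) ^+ 2.
    by rewrite ab cd mulr1.
  by ring.
have y1 : -1 < b * c - a * d < 1 by apply/andP; split; nra.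
split=> //; have y1' : -1 <= b * c - a * d <= 1 by case/andP: y1 => *; apply/andP; split; exact: ltW.
rewrite /unit_path asinK ?in_itv // cos_asin // E sqrtr_sqr gtr0_norm //.
apply/eqP; rewrite eq_complex /=; apply/andP; split; apply/eqP.
  rewrite -[LHS]mulr1 -cd; ring.
rewrite -[LHS]mulr1 -cd; ring.
Qed.

Lemma Re_continuous : continuous (fun z : C => complex.Re z : R).
Proof.
move=> z A /nbhs_ballP[e e0 He]; apply/nbhs_modulusP; exists e => // w wz.
apply: He; rewrite -ball_normE /=; apply: le_lt_trans wz.
by rewrite modulus_distC -raddfB; exact: Re_le_modulus.
Qed.

Lemma Im_continuous : continuous (fun z : C => complex.Im z : R).
Proof.
move=> z A /nbhs_ballP[e e0 He]; apply/nbhs_modulusP; exists e => // w wz.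
apply: He; rewrite -ball_normE /=; apply: le_lt_trans wz.
by rewrite modulus_distC -raddfB; exact: Im_le_modulus.
Qed.

Lemma disc_uniformly_continuous (F : C -> C) r : continuous F ->
  exists2 d, 0 < d & forall z w, nc z <= r -> nc (w - z) < d -> nc (F w - F z) < 1.
Proof.
move=> cF; have /compact_near_coveringP cov := @compact_disc R 0 r.
have := cov R 0^'+ (fun d z => forall w, nc (w - z) < d -> nc (F w - F z) < 1) _ _.
have hyp z : [set z : C | nc (z - 0) <= r] z -> \forall z' \near z & d \near (0 : R)^'+,
    forall w, nc (w - z') < d -> nc (F w - F z') < 1.
  move=> _; have h0 : 0 < 2^-1 :> R by rewrite invr_gt0.
  have /nbhs_modulusP[e e0 He] := cF z _ (nbhs_modulus (F z) h0).
  have e2 : 0 < e / 2 by rewrite divr_gt0.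
  exists ([set z' : C | nc (z' - z) < e / 2], [set d | d < e / 2]).
    by split; [exact: nbhs_modulus|exact: nbhs_right_lt].
  move=> [z' d] /= [z'z de] w wz'.
  have /He /= : nc (z' - z) < e by move: z'z => ?; lra.
  have /He /= : nc (w - z) < e.
    by have := modulus_triangle w z' z; move: z'z wz' => ? ? ?; lra.
  have := modulus_triangle (F w) (F z) (F z'); rewrite (modulus_distC (F z)).
  by move=> ? ? ?; lra.
move=> /(_ _ hyp) Hd.
near (0 : R)^'+ => d.
exists d; first by near: d; exact: nbhs_right_gt.
move=> z w zr wz; have : [set z : C | nc (z - 0) <= r] z by rewrite /= subr0.
move=> H; move: w wz; move: z H {zr}.
by near: d.
Unshelve. all: by end_near. Qed.

(* The angle of [F] is obtained by adding up the small angles between the values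
   of [F] at the points [(k / N) z] of the segment from [0] to [z]. *)
Lemma circle_valued_lift (F : C -> C) r : 0 <= r -> continuous F -> (forall z, nc (F z) = 1) ->
  exists T : C -> R, forall z, nc z <= r -> {for z, continuous T} /\ F z = unit_path (T z) * F 0.
Proof.
move=> r0 cF F1; have [d d0 Hd] := disc_uniformly_continuous r cF.
(* [N] equal steps along a segment of length at most [r] are each shorter than [d], so consecutive
   values of [F] differ by less than 1. *)
pose N := (Num.bound (r / d)).+1.
have N0 : 0 < N%:R :> R by rewrite ltr0n.
have rN : r / N%:R < d.
  rewrite ltr_pdivrMr // mulrC -ltr_pdivrMr //.
  apply: (lt_le_trans (archi_boundP _)); first by rewrite divr_ge0 // ltW.
  by rewrite ler_nat /N.
pose sc (k : nat) z : C := ((k%:R / N%:R)%:C)%C * z.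
pose T n z : R := \sum_(k < n) asin (cross (F (sc k.+1 z)) (F (sc k z))).
have sc_close k z : nc z <= r -> (k <= N)%N -> nc (sc k z) <= r /\ nc (sc k.+1 z - sc k z) < d.
  move=> zr kN; split.
    rewrite modulusM modulus_real ger0_norm ?divr_ge0 // -[leRHS]mul1r.
    by rewrite ler_pM ?modulus_ge0 ?divr_ge0 // ler_pdivrMr // mul1r ler_nat.
  rewrite /sc -mulrBl -rmorphB modulusM modulus_real -mulrBl -natr1 addrC addKr.
  rewrite ger0_norm ?divr_ge0 //; apply: le_lt_trans rN.
  by rewrite mul1r mulrC ler_wpM2r // invr_ge0.
have small k z : nc z <= r -> (k <= N)%N ->
    -1 < cross (F (sc k.+1 z)) (F (sc k z)) < 1 /\
    F (sc k.+1 z) = unit_path (asin (cross (F (sc k.+1 z)) (F (sc k z)))) * F (sc k z).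
  move=> zr kN; have [skr skd] := sc_close k z zr kN.
  by apply: cross_small; rewrite ?F1 //; exact: Hd.
exists (T N) => z zr; split.
  rewrite /T /= (_ : (fun _ => _) = \sum_(k < N) (fun z => asin (cross (F (sc k.+1 z)) (F (sc k z))))); last first.
    by apply/funext => x; rewrite fct_sumE.
  have csc k : continuous (sc k).
    move=> x A HA; have -> : sc k = (fun z : C => ((((k%:R / N%:R)%:C)%C *: 'X).[z] : C)).
      by apply/funext => y; rewrite hornerZ hornerX.
    apply: horner_continuous; rewrite hornerZ hornerX; exact: HA.
  have cFk k : continuous (fun z => F (sc k z)).
    by move=> x; apply: continuous_comp; [exact: csc|exact: cF].
  elim/big_ind : _ => [|f g cf cg|k _].
  - move=> *; exact: cst_continuous.
  - exact: continuousD.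
  apply: (@continuous_comp C R R (fun z => cross (F (sc k.+1 z)) (F (sc k z))) asin); last first.
    by apply: continuous_asin; case: (small k z zr (ltnW (ltn_ord k))).
  have cRe j : continuous (fun z => complex.Re (F (sc j z))).
    by move=> x; apply: (@continuous_comp C C R (fun z => F (sc j z)) (@complex.Re R)); [exact: cFk|exact: Re_continuous].
  have cIm j : continuous (fun z => complex.Im (F (sc j z))).
    by move=> x; apply: (@continuous_comp C C R (fun z => F (sc j z)) (@complex.Im R)); [exact: cFk|exact: Im_continuous].
  by apply: continuousB; apply: continuousM; first [exact: cRe|exact: cIm].
have H n : (n <= N)%N -> F (sc n z) = unit_path (T n z) * F 0.
  elim: n => [|n IH] nN.
    rewrite /T big_ord0 /sc !mul0r /unit_path cos0 sin0.
    by rewrite (_ : (1 +i* 0)%C = 1) ?mul1r.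
  rewrite (small n z zr (ltnW nN)).2; set a := asin _.
  rewrite IH ?(ltnW nN) // mulrA -unit_pathD; congr (unit_path _ * _).
  by rewrite addrC /T big_ord_recr.
rewrite -H //; congr F; rewrite /sc divff ?mul1r //.
by rewrite gt_eqF.
Qed.

(** An angle with two values on a connected set takes all values in between, among them two at a
    distance [d] with [0 < d < pi]. The sine of [d] does not vanish, so the unit vectors there would
    differ. *)
Lemma unit_path_locally_injective (S : set C) (T : C -> R) (v : C) : connected S ->
  (forall z, S z -> {for z, continuous T}) -> (forall z, S z -> unit_path (T z) = v) ->
  forall x y, S x -> S y -> T x = T y.
Proof.
move=> cS cT Tv.
have wl x y : S x -> S y -> ~ T x < T y.
  move=> Sx Sy xy.
  have : connected (T @` S).
    apply: connected_continuous_connected => //; apply: continuous_in_subspaceT.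
    by move=> z; rewrite inE; exact: cT.
  move=> /connected_intervalP itv.
  pose d := Num.min (T y - T x) (pi / 2).
  have d0 : 0 < d by rewrite lt_min subr_gt0 xy divr_gt0 ?pi_gt0.
  have dpi : d < pi.
    by rewrite gt_min; apply/orP; right; have := pi_gt0 R => ?; lra.
  have : (T @` S) (T x + d).
    apply: (itv (T x) (T y)); [by exists x|by exists y|].
    rewrite lerDl (ltW d0) /=; have : d <= T y - T x by rewrite ge_min lexx.
    by move=> ?; lra.
  move=> [z Sz Tz]; have := Tv _ Sz; rewrite Tz unit_pathD (Tv _ Sx).
  have v0 : v != 0 by rewrite -modulus_gt0 -(Tv _ Sx) modulus_unit_path.
  move=> /(congr1 (fun u => v^-1 * u)); rewrite mulKf // mulVf // => -[_ sd].
  by have := @sin_gt0_pi R d; rewrite d0 dpi sd ltxx => /(_ isT).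
move=> x y Sx Sy; apply/eqP; rewrite eq_le !leNgt; apply/andP; split; apply/negP.
  exact: wl.
exact: wl.
Qed.

(* If [L `&` E] were the disjoint union of closed sets [A] and [B], the map
   [exp(2 pi i f)] on [L], with [f] equal to 0 on [A] and to 1 on [B], extended
   by 1 to [E], would have a continuous angle: constant on [E], but increasing
   by [2 pi] from [A] to [B] along [L]. *)
Lemma plane_unicoherence (L E : set C) r : 0 <= r -> closed L -> closed E -> L `|` E = setT ->
  L `<=` [set z | nc z <= r] -> connected L -> connected (E `&` [set z | nc z <= r]) ->
  connected (L `&` E).
Proof.
move=> r0 cL cE LE Lr conL conE; apply: contrapT => /(closed_disconnect (closedI cL cE)).
move=> [A [B [cA cB [a Aa] [b Bb] [LEAB AB]]]].
have /normal_openP /normal_separatorP norm : forall A B : set C, closed A -> closed B -> A `&` B = set0 ->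
  exists U V, [/\ open U, open V, A `<=` U, B `<=` V & U `&` V = set0].
  exact: closed_separation.
have [f [cf _ fA fB]] := (@uniform_separatorP C R A B).1 (norm R R _ _ cA cB AB).
have f0 z : A z -> f z = 0 by move=> Az; apply: fA; exists z.
have f1 z : B z -> f z = 1 by move=> Bz; apply: fB; exists z.
pose G z : C := unit_path (pi *+ 2 * f z).
have G1 z : L z -> E z -> G z = 1.
  move=> Lz Ez; have : (L `&` E) z by []; rewrite LEAB /G => -[/f0|/f1] ->.
    by rewrite mulr0 /unit_path cos0 sin0.
  by rewrite mulr1 /unit_path cos2pi sin2pi.
pose F z : C := if pselect (L z) then G z else 1.
have FL z : L z -> F z = G z by rewrite /F; case: pselect.
have FE z : E z -> F z = 1 by rewrite /F; case: pselect => // Lz Ez; exact: G1.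
have cf2 : continuous (fun z => pi *+ 2 * f z : R).
  by move=> z; apply: (@continuousM R C (cst (pi *+ 2)) f z); [exact: cst_continuous|exact: cf].
have cG : continuous G.
  move=> z; apply: (@continuous_comp C R C (fun z => pi *+ 2 * f z) unit_path).
    exact: cf2.
  exact: unit_path_continuous.
have cF : continuous F.
  have : {within [set: C], continuous F}.
    rewrite -LE; apply: withinU_continuous => //.
      apply: (@subspace_eq_continuous _ _ _ G); last exact: continuous_subspaceT.
      by move=> z; rewrite inE => /FL.
    apply: (@subspace_eq_continuous C E C (cst (1 : C))); last exact/continuous_subspaceT/cst_continuous.
    by move=> z; rewrite inE => /FE.
  by rewrite -continuous_subspace_setT.
have F1 z : nc (F z) = 1.
  by rewrite /F; case: pselect => ?; [exact: modulus_unit_path|exact: modulus1].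
have [T HT] := circle_valued_lift r0 cF F1.
have F00 : F 0 != 0 by rewrite -modulus_gt0 F1.
have Aab : (L `&` E) a by rewrite LEAB; left.
have Bab : (L `&` E) b by rewrite LEAB; right.
have TE : T a = T b.
  apply: (unit_path_locally_injective (v := (F 0)^-1) conE).
  - by move=> z [_ /HT []].
  - move=> z [Ez zr]; have [_] := HT z zr; rewrite FE // => H.
    by rewrite -[RHS]mul1r H mulfK.
  - by split; [exact: Aab.2|exact: Lr Aab.1].
  - by split; [exact: Bab.2|exact: Lr Bab.1].
have : T a - pi *+ 2 * f a = T b - pi *+ 2 * f b.
  apply: (unit_path_locally_injective (T := fun z => T z - pi *+ 2 * f z) (v := (F 0)^-1) conL).
  - by move=> z Lz; apply: continuousB; [case: (HT z (Lr z Lz))|exact: cf2].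
  - move=> z Lz; have [_] := HT z (Lr z Lz); rewrite FL // /G.
    have -> : T z = (T z - pi *+ 2 * f z) + pi *+ 2 * f z by rewrite subrK.
    rewrite unit_pathD addrK => H.
    have G0 : unit_path (pi *+ 2 * f z) != 0 :> C by rewrite -modulus_gt0 modulus_unit_path.
    apply: (mulIf F00); apply: (mulIf G0); rewrite mulVf // mul1r [RHS]H; ring.
  - exact: Aab.1.
  - exact: Bab.1.
rewrite TE f0 // f1 // mulr0 mulr1 => /addrI /oppr_inj /esym /eqP.
by rewrite mulrn_eq0 /= gt_eqF // pi_gt0.
Qed.

(** The curve is the intersection of a sublevel and a superlevel set that cover the plane, so
    unicoherence applies: the sublevel set is connected by the hypothesis on critical values, the
    superlevel set, within a large disc, because [|g|] has no local maxima. *)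
Lemma level_set_connected g r : (1 < size g)%N -> 0 < r ->
  (forall c, g^`().[c] = 0 -> nc g.[c] < r) ->
  connected [set z : C | nc g.[z] = r].
Proof.
move=> sg r0 Hcrit; have [s0 Hs0] := horner_growth r sg.
pose s := Num.max 1 s0.
have s1 : 0 < s by rewrite lt_max ltr01.
have Hs z : nc g.[z] <= r -> nc z < s.
  rewrite !leNgt => H; rewrite ltNge; apply: contra H; rewrite /s ge_max => /andP[_].
  exact: Hs0.
rewrite (_ : [set z : C | _] = [set z : C | nc g.[z] <= r] `&` [set z : C | r <= nc g.[z]]).
  apply: (@plane_unicoherence _ _ s (ltW s1)).
  - exact/closed_sublevel/modulus_horner_continuous.
  - exact/closed_superlevel/modulus_horner_continuous.
  - by apply/seteqP; split=> // z _; have [] := lerP (nc g.[z]) r; [left|move/ltW; right].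
  - by move=> z /Hs /ltW.
  - exact: sublevel_connected.
  - exact: superlevel_in_disc_connected.
apply/seteqP; split=> z /=; first by move=> ->; split => /=.
by move=> [zr rz]; apply/eqP; rewrite eq_le zr rz.
Qed.

End Unicoherence.

(** * Fibers of the semigroup *)

Section WordDynamics.
Context {R : realType} {m : nat}.
Local Notation C := (cplx R).
Local Notation nc := (@Normc.normc R).
Implicit Types (z x y : C) (h : 'I_m.+1 -> {poly R[i]}) (w v : nat -> 'I_m.+1).

(** New letters are composed on the outside: words with a common prefix share their first
    compositions, and an orbit continues as the orbit of its current point under a shifted word. *)
Fixpoint word_comp h w n : {poly R[i]} :=
  if n is n'.+1 then h (w n') \Po word_comp h w n' else 'X.

Definition word_shift w n : nat -> 'I_m.+1 := fun i => w (n + i)%N.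

Lemma word_compS h w n z : (word_comp h w n.+1).[z] = (h (w n)).[(word_comp h w n).[z]].
Proof. exact: horner_comp. Qed.

Lemma word_compD h w n k : word_comp h w (n + k) = word_comp h (word_shift w n) k \Po word_comp h w n.
Proof.
elim: k => [|k IH]; first by rewrite addn0 comp_polyX.
by rewrite addnS /= IH comp_polyA.
Qed.

Lemma horner_word_compD h w n k z :
  (word_comp h w (n + k)).[z] = (word_comp h (word_shift w n) k).[(word_comp h w n).[z]].
Proof. by rewrite word_compD horner_comp. Qed.

Lemma eq_word_comp h w v n : (forall i, (i < n)%N -> w i = v i) ->
  word_comp h w n = word_comp h v n.
Proof.
elim: n => //= n IH H; rewrite IH; first by rewrite H.
by move=> i ni; apply: H; apply: ltnW.
Qed.

Lemma deg_comp (p q : {poly R[i]}) : deg (p \Po q) = (deg p * deg q)%N.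
Proof. by rewrite /deg size_comp_poly. Qed.

Lemma deg_word_compS h w n : deg (word_comp h w n.+1) = (deg (h (w n)) * deg (word_comp h w n))%N.
Proof. exact: deg_comp. Qed.

Lemma deg_word_compD h w n k : deg (word_comp h w (n + k)) =
  (deg (word_comp h (word_shift w n) k) * deg (word_comp h w n))%N.
Proof. by rewrite word_compD deg_comp. Qed.

Lemma generated_word_comp h w n : generated (range h) (word_comp h w n.+1).
Proof.
have hG j : generated (range h) (h j) by apply: generated_gen; exists j.
elim: n => [|n IH]; first by rewrite /= comp_polyXr.
exact: generated_comp.
Qed.

Definition word_cat w n v : nat -> 'I_m.+1 := fun i => if (i < n)%N then w i else v (i - n)%N.

Lemma word_comp_cat h w n v k :
  word_comp h (word_cat w n v) (n + k) = word_comp h v k \Po word_comp h w n.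
Proof.
rewrite word_compD (@eq_word_comp _ (word_cat w n v) w n) => [|i Hi]; last by rewrite /word_cat Hi.
rewrite (@eq_word_comp _ _ v k) // => i _; rewrite /word_shift /word_cat.
by case: ifP => [H|_]; [exfalso; lia|congr v; lia].
Qed.

Lemma generated_is_word_comp h g : generated (range h) g ->
  exists w n, g = word_comp h w n.
Proof.
elim=> [_ [j _ <-]|f1 f2 _ [w1 [n1 ->]] _ [w2 [n2 ->]]].
  by exists (fun=> j), 1%N; rewrite /= comp_polyXr.
by exists (word_cat w2 n2 w1), (n2 + n1)%N; rewrite word_comp_cat.
Qed.

(** [2 <= a * r] makes every generator at least double moduli beyond [r]. The two bounds are shaped
    for iteration: under a composition of degree [e], [a |z|] becomes at least its [e]-th power when
    [|z| >= r], and [b max(1, |z|)] at most its [e]-th power. *)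
Record escape_constants h (a b r : R) : Prop := EscapeConstants {
  escape_deg : forall j, (2 <= deg (h j))%N;
  escape_a0 : 0 < a;
  escape_a1 : a <= 1;
  escape_b1 : 1 <= b;
  escape_r1 : 1 <= r;
  escape_ar : 2 <= a * r;
  escape_upper : forall j z, nc (h j).[z] <= b * Num.max 1 (nc z) ^+ deg (h j);
  escape_lower : forall j z, r <= nc z -> a * nc z ^+ deg (h j) <= nc (h j).[z];
  escape_critical : forall w n z, (word_comp h w n)^`().[z] = 0 ->
    nc (word_comp h w n).[z] < r }.

Section Escape.
Context {h : 'I_m.+1 -> {poly R[i]}} {a b r : R}.
Context (Hesc : escape_constants h a b r).

Let hdeg := escape_deg Hesc.
Let a0 := escape_a0 Hesc.
Let a1 := escape_a1 Hesc.
Let b1 := escape_b1 Hesc.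
Let r1 := escape_r1 Hesc.
Let ar := escape_ar Hesc.
Let r0 : 0 < r := lt_le_trans ltr01 r1.

Local Notation g w n := (word_comp h w n).

Lemma deg_word_comp_ge w n : (2 ^ n <= deg (g w n))%N.
Proof.
elim: n => [|n IH]; first by rewrite /deg size_polyX.
by rewrite deg_word_compS expnS leq_mul.
Qed.

Lemma deg_word_comp_gt0 w n : (0 < deg (g w n))%N.
Proof. by apply: leq_trans (deg_word_comp_ge w n); rewrite expn_gt0. Qed.

Lemma size_word_comp w n : (1 < size (g w n))%N.
Proof. by have := deg_word_comp_gt0 w n; rewrite /deg; case: (size _) => [|[]]. Qed.

(** The factor [a] lets the bound iterate without accumulating constants:
    [(a |y|)^d <= a (a |y|^d) <= a |h(y)|], since [a <= 1] and [d >= 2]. *)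
Lemma word_comp_lower_bound w n z : r <= nc z ->
  [/\ r <= nc (g w n).[z], 2 ^+ n * nc z <= nc (g w n).[z] &
      (a * nc z) ^+ deg (g w n) <= a * nc (g w n).[z]].
Proof.
move=> rz; elim: n => [|n [IH1 IH2 IH3]].
  by rewrite hornerX expr0 mul1r rz lexx /deg size_polyX expr1.
rewrite word_compS deg_word_compS; set y := (g w n).[z] in IH1 IH2 IH3 *.
set d := deg (h (w n)); have d2 : (2 <= d)%N by exact: hdeg.
have y1 : 1 <= nc y by exact: le_trans IH1.
have hy := escape_lower Hesc (w n) IH1; rewrite -/d in hy.
have hy2 : 2 * nc y <= nc (h (w n)).[y].
  apply: le_trans hy; apply: (@le_trans _ _ (a * nc y ^+ 2)).
    rewrite expr2 mulrA ler_wpM2r ?modulus_ge0 //.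
    by apply: (le_trans ar); rewrite ler_pM2l.
  by rewrite ler_pM2l //; apply: ler_weXn2l.
split.
- by apply: le_trans hy2; apply: (le_trans IH1); rewrite ler_peMl ?modulus_ge0 // ler1n.
- by rewrite exprS -mulrA; apply: le_trans hy2; rewrite ler_pM2l.
rewrite mulnC exprM.
apply: (@le_trans _ _ ((a * nc y) ^+ d)).
  by apply: lerXn2r; rewrite ?nnegrE ?exprn_ge0 ?mulr_ge0 ?modulus_ge0 ?(ltW a0).
rewrite exprMn; apply: (@le_trans _ _ (a * (a * nc y ^+ d))); last by rewrite ler_pM2l.
rewrite mulrA ler_wpM2r ?exprn_ge0 ?modulus_ge0 // -expr2.
by apply: ler_wiXn2l => //; exact: ltW.
Qed.

Lemma word_comp_upper_bound w n z :
  b * Num.max 1 (nc (g w n).[z]) <= (b * Num.max 1 (nc z)) ^+ deg (g w n).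
Proof.
elim: n => [|n IH]; first by rewrite hornerX /deg size_polyX expr1.
rewrite word_compS deg_word_compS; set y := (g w n).[z] in IH *.
set d := deg (h (w n)); have d2 : (2 <= d)%N by exact: hdeg.
have hy := escape_upper Hesc (w n) y; rewrite -/d in hy.
have b0 : 0 < b := lt_le_trans ltr01 b1.
have M1 : 1 <= Num.max 1 (nc y) by rewrite le_max lexx.
have M0 : 0 <= Num.max 1 (nc y) := le_trans ler01 M1.
rewrite mulnC exprM; apply: (@le_trans _ _ ((b * Num.max 1 (nc y)) ^+ d)); last first.
  by apply: lerXn2r; rewrite ?nnegrE ?exprn_ge0 ?mulr_ge0 ?(ltW b0) // le_max ler01.
apply: (@le_trans _ _ (b * (b * Num.max 1 (nc y) ^+ d))).
  rewrite ler_pM2l // ge_max hy andbT.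
  by apply: mulr_ege1 => //; apply: exprn_ege1.
rewrite mulrA exprMn ler_wpM2r ?exprn_ge0 // -expr2.
by apply: ler_weXn2l.
Qed.

(** An orbit is bounded if and only if it never reaches modulus [r]. Since orbits at modulus [r]
    move strictly beyond it, [<= r] would define the same set, which is therefore closed; removing
    its interior leaves its boundary. *)
Definition filled_julia w : set C := [set z | forall n, nc (g w n).[z] < r].

Definition fiber_julia w : set C := filled_julia w `\` (filled_julia w)°.

Lemma escape_forever w n k z : r <= nc (g w n).[z] ->
  2 ^+ k * r <= nc (g w (n + k)%N).[z].
Proof.
rewrite horner_word_compD => rn.
have [_ H _] := word_comp_lower_bound (word_shift w n) k rn.
by apply: le_trans H; rewrite ler_pM2l ?exprn_gt0.
Qed.

Lemma escape_mono w n k z : (n <= k)%N -> r <= nc (g w n).[z] -> r <= nc (g w k).[z].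
Proof.
move=> /subnKC <-; rewrite horner_word_compD.
by move=> /(word_comp_lower_bound (word_shift w n) (k - n)) [].
Qed.

Lemma escape_strict w n k z : (n < k)%N -> r <= nc (g w n).[z] -> r < nc (g w k).[z].
Proof.
move=> nk rn0; have := @escape_forever w n 1 z rn0; rewrite addn1 expr1 => H.
have {}H : 2 * r <= nc (g w n.+1).[z] by [].
have r2 : r < 2 * r by rewrite ltr_pMl // ltr1n.
have rn : r <= nc (g w n.+1).[z] by exact: le_trans (ltW r2) H.
move: nk => /subnKC <-; rewrite horner_word_compD.
have [_ H2 _] := word_comp_lower_bound (word_shift w n.+1) (k - n.+1) rn.
apply: lt_le_trans H2; apply: (lt_le_trans r2); apply: (le_trans H).
by rewrite ler_peMl ?modulus_ge0 // exprn_ege1 // ler1n.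
Qed.

Lemma not_filled_julia w z : ~ filled_julia w z -> exists n, r <= nc (g w n).[z].
Proof.
by move=> /existsNP [n /negP]; rewrite -leNgt; exists n.
Qed.

Lemma filled_julia_le w z : (forall n, nc (g w n).[z] <= r) -> filled_julia w z.
Proof.
move=> H; apply: contrapT => /not_filled_julia [n rn].
by have := escape_strict (ltnSn n) rn; rewrite ltNge H.
Qed.

Lemma filled_julia_closed w : closed (filled_julia w).
Proof.
rewrite (_ : filled_julia w = \bigcap_n [set z : C | nc (g w n).[z] <= r]).
  by apply: closed_bigI => n _; exact/closed_sublevel/modulus_horner_continuous.
apply/seteqP; split=> [z Kz n _|z H]; first exact: ltW.
by apply: filled_julia_le => n; exact: H.
Qed.

Lemma filled_julia_bounded w z : filled_julia w z -> nc z < r.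
Proof. by move=> /(_ 0%N); rewrite /= hornerX. Qed.

Lemma connected_avoids_fiber w (D : set C) : connected D -> D `&` fiber_julia w = set0 ->
  D `<=` filled_julia w \/ D `&` filled_julia w = set0.
Proof.
move=> cD DJ.
have DU : D `<=` (filled_julia w)° `|` ~` filled_julia w.
  move=> z Dz; have [Kz|nKz] := pselect (filled_julia w z); last by right.
  left; apply: contrapT => nz; have : (D `&` fiber_julia w) z by [].
  by rewrite DJ.
have dis : (filled_julia w)° `&` ~` filled_julia w = set0.
  by rewrite -subset0 => z [/interior_subset].
have := connected_disjoint_open (open_interior _) (closed_openC (@filled_julia_closed w)) dis DU cD.
case=> H; [left|right]; first by apply: subset_trans H _; exact: interior_subset.
by rewrite -subset0 => z [/H].
Qed.

Definition level_curve w n : set C := [set z | nc (g w n).[z] = r].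

Lemma level_curve_connected w n : connected (level_curve w n).
Proof.
apply: level_set_connected => //; first exact: size_word_comp.
by move=> c; exact: (escape_critical Hesc).
Qed.

Lemma level_curve_bounded w n z : level_curve w n z -> nc z <= r.
Proof.
move=> gz; rewrite leNgt; apply/negP => rz.
have [_ H _] := word_comp_lower_bound w n (ltW rz).
have H2 : nc z <= 2 ^+ n * nc z by rewrite ler_peMl ?modulus_ge0 // exprn_ege1 // ler1n.
by have := lt_le_trans rz (le_trans H2 H); rewrite gz ltxx.
Qed.

(** Points of level curves outside [U] would cluster at some [z]. Each fixed [g w k] has modulus at
    most [r] at the later ones, which puts [z] in the filled Julia set; they escape themselves,
    which keeps [z] off its interior. *)
Lemma fiber_julia_limit w (U : set C) : open U -> fiber_julia w `<=` U ->
  exists N, forall n, (N <= n)%N -> level_curve w n `<=` U.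
Proof.
move=> oU JU; apply: contrapT => /forallNP nH.
have {}nH N : exists nz : nat * C, [/\ (N <= nz.1)%N, level_curve w nz.1 nz.2 & ~ U nz.2].
  have := nH N => /existsNP [n /not_implyP [Nn /existsNP [z /not_implyP [Az nUz]]]].
  by exists (n, z).
have [f Hf] := choice nH.
have cpt : compact ([set z : C | nc (z - 0) <= r] `&` ~` U).
  by apply: compact_closedI; [exact: compact_disc|exact: open_closedC].
have [|z [[zr nUz] clz]] := cpt ((fun N => (f N).2) @ \oo) _.
  exists 0%N => // N _ /=; have [_ Az nU] := Hf N; split=> //.
  by rewrite /= subr0; exact: level_curve_bounded Az.
have cl (B : set C) k : closed B -> (forall N, (k <= N)%N -> B (f N).2) -> B z.
  move=> cB HB; apply: cB; rewrite clusterE in clz; apply: (clz B).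
  by exists k.
apply/nUz/JU; split.
  apply: filled_julia_le => k; apply: (cl [set z : C | nc (g w k).[z] <= r] k).
    exact/closed_sublevel/modulus_horner_continuous.
  move=> N kN /=; have [Nn Az _] := Hf N.
  rewrite leNgt; apply/negP => rk.
  have := leq_trans kN Nn; rewrite leq_eqVlt => /orP[/eqP Ek|kn].
    by move: rk; rewrite Ek Az ltxx.
  by have := escape_strict kn (ltW rk); rewrite Az ltxx.
move=> iz; have [|y [[N _ <-] Ky]] := clz [set (f N).2 | N in setT] _ _ iz.
  by exists 0%N => // N _; exists N.
by have [_ Az _] := Hf N; have := Ky (f N).1; rewrite Az ltxx.
Qed.

(** Some [y] near [z] escapes. For large [n] the modulus of [g w n] is below [r] at [z] and above
    [r] at [y], so a disc containing both crosses the level [r]. *)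
Lemma fiber_julia_approx w (V : set C) z : open V -> fiber_julia w z -> V z ->
  exists N, forall n, (N <= n)%N -> level_curve w n `&` V !=set0.
Proof.
move=> oV [Kz nint] Vz; have /nbhs_modulusP[d d0 Hd] := open_nbhs_nbhs (conj oV Vz).
have [y [yd nKy]] : exists y, nc (y - z) < d /\ ~ filled_julia w y.
  apply: contrapT => /forallNP H; apply: nint; apply/nbhs_modulusP; exists d => // y yd.
  by apply: contrapT => nK; exact: (H y).
have [n0 Hn0] := not_filled_julia nKy.
exists n0.+1 => n nn0; apply: contrapT => /nonemptyPn AV.
pose B := [set x : C | nc (x - z) < d].
have BU : B `<=` [set x | nc (g w n).[x] < r] `|` [set x | r < nc (g w n).[x]].
  move=> x Bx; have : ~ level_curve w n x.
    by move=> Ax; have := conj Ax (Hd x Bx) : (level_curve w n `&` V) x; rewrite AV.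
  rewrite /level_curve /= => /eqP; rewrite neq_lt => /orP[]; by [left|right].
have o1 : open [set x : C | nc (g w n).[x] < r].
  exact/open_sublevel/modulus_horner_continuous.
have o2 : open [set x : C | r < nc (g w n).[x]].
  exact/open_superlevel/modulus_horner_continuous.
have o12 : [set x : C | nc (g w n).[x] < r] `&` [set x : C | r < nc (g w n).[x]] = set0.
  by rewrite -subset0 => x [/= /lt_trans H /H]; rewrite ltxx.
have Bz : B z by rewrite /B /= subrr modulus0.
case: (connected_disjoint_open o1 o2 o12 BU (@open_disc_connected _ z d d0)) => H.
  have := H y yd; rewrite /= ltNge; move/negP; apply.
  exact: ltW (escape_strict nn0 Hn0).
by have := H z Bz; rewrite /= ltNge (ltW (Kz n)).
Qed.

(** Connected level curves stand in for connectedness of [J w]: for large [n] they lie in the union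
    of [U] and [V], and they meet [U]. *)
Lemma fiber_julia_side w (U V : set C) : open U -> open V -> U `&` V = set0 ->
  fiber_julia w `<=` U `|` V -> fiber_julia w `&` U !=set0 ->
  exists N, forall n, (N <= n)%N -> level_curve w n `<=` U.
Proof.
move=> oU oV UV JUV [z [Jz Uz]].
have [N1 HN1] := fiber_julia_limit (openU oU oV) JUV.
have [N2 HN2] := fiber_julia_approx oU Jz Uz.
exists (maxn N1 N2) => n; rewrite geq_max => /andP[/HN1 AUV /HN2 [x [Ax Ux]]].
case: (connected_disjoint_open oU oV UV AUV (level_curve_connected (w := w) (n := n))) => // AV.
by have := conj Ux (AV x Ax) : (U `&` V) x; rewrite UV.
Qed.

Lemma fiber_julia_one_side w (U V : set C) : open U -> open V -> U `&` V = set0 ->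
  fiber_julia w `<=` U `|` V -> fiber_julia w `&` U !=set0 -> fiber_julia w `&` V = set0.
Proof.
move=> oU oV UV JUV JU; have [N HN] := fiber_julia_side oU oV UV JUV JU.
rewrite -subset0 => z [Jz Vz]; have [N' HN'] := fiber_julia_approx oV Jz Vz.
have [x [Ax Vx]] := HN' (maxn N N') (leq_maxr _ _).
by have := conj (HN _ (leq_maxl _ _) x Ax) Vx : (U `&` V) x; rewrite UV.
Qed.

Lemma fiber_julia_nonempty w z : filled_julia w z -> fiber_julia w !=set0.
Proof.
move=> Kz; apply: contrapT => /nonemptyPn J0.
have := @connected_avoids_fiber w setT (@connected_cplx R); rewrite setTI => /(_ J0).
case=> [H|]; last by rewrite setTI => K0; move: Kz; rewrite K0.
by have := filled_julia_bounded (H (r%:C)%C I); rewrite modulus_real gtr0_norm ?ltxx.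
Qed.

End Escape.
End WordDynamics.

(** * Comparison of fibers and limits of words *)

Section Ordering.
Context {R : realType} {m : nat}.
Local Notation C := (cplx R).
Local Notation nc := (@Normc.normc R).
Implicit Types (z x y : C) (w v : nat -> 'I_m.+1).

(** Compactness of the space of words: [w i] is the letter that [f n i] takes along an ultrafilter
    containing all tails; there is one because the alphabet is finite. *)
Lemma word_cluster (f : nat -> nat -> 'I_m.+1) :
  exists w, forall N n0, exists2 n, (n0 <= n)%N & forall i, (i < N)%N -> f n i = w i.
Proof.
have [U [UU ooU]] := ultraFilterLemma (eventually_filter : ProperFilter \oo).
have H i : exists j, U [set n | f n i = j].
  apply: contrapT => /forallNP nU.
  have {}nU j : U (~` [set n | f n i = j]).
    by have [/nU|] := in_ultra_setVsetC [set n | f n i = j] UU.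
  have /filter_ex [n Hn] : U [set n | forall j, f n i <> j] by apply: filter_forall.
  exact: Hn _ erefl.
have [w Hw] := choice H; exists w => N n0.
have : U [set n | (n0 <= n)%N /\ forall i : 'I_N, f n i = w i].
  apply: filterI; first by apply: ooU; exists n0.
  by apply: filter_forall => i; exact: Hw.
by move=> /filter_ex [n [n0n Hn]]; exists n => // i iN; exact: (Hn (Ordinal iN)).
Qed.

Context {h : 'I_m.+1 -> {poly R[i]}} {a b r : R}.
Context (Hesc : escape_constants h a b r).
Let r1 := escape_r1 Hesc.
Let r0 : 0 < r := lt_le_trans ltr01 r1.
Local Notation g w n := (word_comp h w n).
Local Notation K := (@filled_julia R m h r).
Local Notation J := (@fiber_julia R m h r).
Local Notation A := (@level_curve R m h r).

(** The sets [{|g w n| < r}] decrease and their intersection misses the compact set [D], so one of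
    them already does. *)
Lemma compact_escape w (D : set C) : compact D -> D `&` K w = set0 ->
  exists N, forall n z, (N <= n)%N -> D z -> r <= nc (g w n).[z].
Proof.
move=> cD DK; suff [N HN] : exists N, forall z, D z -> r <= nc (g w N).[z].
  by exists N => n z Nn /HN; exact: (escape_mono Hesc Nn).
apply: contrapT => /forallNP nH.
have {}nH N : exists z, D z /\ nc (g w N).[z] < r.
  by have := nH N => /existsNP [z /not_implyP [Dz /negP]]; rewrite -ltNge; exists z.
have [f Hf] := choice nH.
have [|z [Dz clz]] := cD (f @ \oo) _.
  by exists 0%N => // N _ /=; have [] := Hf N.
suff : (D `&` K w) z by rewrite DK.
split=> //; apply: (filled_julia_le Hesc) => k.
have cB : closed [set z : C | nc (g w k).[z] <= r].
  exact/closed_sublevel/modulus_horner_continuous.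
rewrite clusterE in clz; apply/cB/clz; exists k => // N kN /=.
have [_ fN] := Hf N; rewrite leNgt; apply/negP => /ltW /(escape_mono Hesc kN).
by rewrite leNgt fN.
Qed.

(** The sublevel sets of [g v k] are connected and contain [K v], hence [z0]. For large [k] they
    miss the curve [A w n] and so stay on the side [{|g w n| < r}] of [z0]. *)
Lemma filled_julia_sub w v N z0 : K w z0 -> K v z0 ->
  (forall n, (N <= n)%N -> A w n `&` K v = set0) -> K v `<=` K w.
Proof.
move=> Kw Kv HA.
have sub n : (N <= n)%N -> K v `<=` [set z | nc (g w n).[z] < r].
  move=> Nn; have cA : compact (A w n).
    apply: (@compact_bounded_closed _ r); last by move=> z; exact: (level_curve_bounded Hesc).
    rewrite (_ : A w n = [set z | nc (g w n).[z] <= r] `&` [set z | r <= nc (g w n).[z]]).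
      apply: closedI; first exact/closed_sublevel/modulus_horner_continuous.
      exact/closed_superlevel/modulus_horner_continuous.
    apply/seteqP; split=> z; first by rewrite /level_curve /= => ->.
    by move=> [/= H1 H2]; apply/eqP; rewrite eq_le H1 H2.
  have [k Hk] := compact_escape cA (HA n Nn).
  (* On the curve [|g v k| >= r]; one more letter makes this strict, so that the closed sublevel set
     misses the curve. *)
  have cL : connected [set z : C | nc (g v k.+1).[z] <= r].
    apply: sublevel_connected => //; first exact: (size_word_comp Hesc).
    by move=> c; exact: (escape_critical Hesc).
  have LU : [set z : C | nc (g v k.+1).[z] <= r] `<=`
      [set z | nc (g w n).[z] < r] `|` [set z | r < nc (g w n).[z]].
    move=> z zk; have : ~ A w n z.
      move=> /(Hk k z (leqnn k)) /(escape_strict Hesc (ltnSn k)).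
      by rewrite ltNge zk.
    by rewrite /level_curve /= => /eqP; rewrite neq_lt => /orP[]; [left|right].
  have o1 : open [set x : C | nc (g w n).[x] < r].
    exact/open_sublevel/modulus_horner_continuous.
  have o2 : open [set x : C | r < nc (g w n).[x]].
    exact/open_superlevel/modulus_horner_continuous.
  have o12 : [set x : C | nc (g w n).[x] < r] `&` [set x : C | r < nc (g w n).[x]] = set0.
    by rewrite -subset0 => x [/= /lt_trans H /H]; rewrite ltxx.
  case: (connected_disjoint_open o1 o2 o12 LU cL) => H.
    by move=> z Kz; apply: H; apply: ltW; exact: Kz.
  by have := H z0 (ltW (Kv k.+1)); rewrite /= ltNge (ltW (Kw n)).
move=> z Kz; apply: contrapT => /not_filled_julia [n rn].
have := sub _ (leq_maxl N n) z Kz.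
by rewrite /= ltNge (escape_mono Hesc (leq_maxr N n) rn).
Qed.

Lemma Psi_word_compS w n (x : R) :
  Psi (g w n.+1) x = Psi (h (w n)) (Psi (g w n) x).
Proof.
have hn0 j : h j != 0.
  by rewrite -size_poly_gt0; have := escape_deg Hesc j; rewrite /deg; case: size.
have gn0 k : g w k != 0.
  by rewrite -size_poly_gt0; exact: ltnW (size_word_comp Hesc w k).
rewrite /Psi deg_word_compS natrM /= lead_coef_comp; last exact: (size_word_comp Hesc).
rewrite modulusM modulusX lnM ?posrE ?exprn_gt0 ?modulus_gt0 ?lead_coef_eq0 //.
rewrite lnXn ?modulus_gt0 ?lead_coef_eq0 // -[_ *+ _]mulr_natl /deg; ring.
Qed.

(* The logarithmic capacity of [{|g w n| <= r}] is the preimage of [ln r] under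
   [Psi (g w n)]: it is larger than [x], while that of [K v] is equal to [x]. *)
Lemma level_curve_not_sub_filled (al be x : R) w v n : be < ln r ->
  (forall n, al <= Psi (g w n) x <= be) -> (forall n, al <= Psi (g v n) x <= be) ->
  ~ (A w n `<=` K v).
Proof.
move=> ber Hw Hv AK; have rpos : 0 < ln r - be by rewrite subr_gt0.
set d := deg (g w n).
(* [B] is the bound that the capacity inequality puts on the degree of [g v k], whatever [k] is; but
   this degree is at least [2^k]. *)
pose B := d%:R * (ln r - al) / (ln r - be).
have B0 : 0 <= B.
  have /andP[h1 h2] := Hw 0%N.
  by rewrite divr_ge0 ?(ltW rpos) // mulr_ge0 // subr_ge0; move: h1 h2 rpos => *; lra.
pose k := Num.bound B; have kB : B < k%:R by exact: archi_boundP.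
have gn0 u j : 0 < nc (lead_coef (g u j)).
  by rewrite modulus_gt0 lead_coef_eq0 -size_poly_gt0 ltnW // (size_word_comp Hesc).
have := @level_set_capacity R (g w n) (g v k) r r (size_word_comp Hesc w n).
rewrite -size_poly_gt0 (ltnW (size_word_comp Hesc v k)) => /(_ isT r0).
have Hsub z : nc (g w n).[z] = r -> nc (g v k).[z] <= r by move=> /AK /(_ k) /ltW.
move=> /(_ Hsub); rewrite -!/(deg _) -/d; set e := deg (g v k).
rewrite -ler_ln ?posrE ?mulr_gt0 ?exprn_gt0 //.
have lnX (t : R) k' : 0 < t -> ln (t ^+ k') = k'%:R * ln t.
  by move=> t0; rewrite lnXn // mulr_natl.
rewrite !lnM ?posrE ?exprn_gt0 // !lnX //.
have /andP[_] := Hw n; have /andP[] := Hv k; rewrite /Psi -/d -/e.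
move=> vk1 _ wn2 cap.
have ke : k%:R <= e%:R :> R.
  rewrite ler_nat; apply: leq_trans (deg_word_comp_ge Hesc v k).
  exact/ltnW/ltn_expl.
have e0 : 0 <= e%:R :> R by rewrite ler0n.
have d0 : 0 <= d%:R :> R by rewrite ler0n.
have : e%:R * (ln r - be) <= d%:R * (ln r - al).
  move: (ln (nc (lead_coef (g w n)))) (ln (nc (lead_coef (g v k)))) wn2 vk1 cap => la lb wn2 vk1 cap.
  have h1 := ler_wpM2l e0 wn2; have h2 := ler_wpM2l d0 vk1.
  by lra.
rewrite -ler_pdivlMr // -/B => eB.
by have := le_lt_trans (le_trans ke eB) kB; rewrite ltxx.
Qed.

(* Two fibers with the same logarithmic capacity [x] cannot be separated: of two
   separated fibers one would be contained in the interior of the other. *)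
Lemma fiber_julia_not_separated (U V : set C) (al be x : R) w v z0 : be < ln r ->
  (forall n, al <= Psi (g w n) x <= be) -> (forall n, al <= Psi (g v n) x <= be) ->
  K w z0 -> K v z0 ->
  open U -> open V -> U `&` V = set0 ->
  (forall u, J u `<=` U `|` V) ->
  J w `&` U !=set0 -> J v `&` V !=set0 -> False.
Proof.
move=> ber Hw Hv Kw Kv oU oV UV JUV JwU JvV.
have VU : V `&` U = set0 by rewrite setIC.
have JVU u : J u `<=` V `|` U by rewrite setUC.
have [N1 HN1] := fiber_julia_side Hesc oU oV UV (JUV w) JwU.
have [N2 HN2] := fiber_julia_side Hesc oV oU VU (JVU v) JvV.
have JvU := fiber_julia_one_side Hesc oV oU VU (JVU v) JvV.
have JwV := fiber_julia_one_side Hesc oU oV UV (JUV w) JwU.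
(* A level curve that avoids [J s] lies in [K s] or misses it; the comparison of capacities excludes
   the former. *)
have out u s (W : set C) n :
    (forall n, al <= Psi (g u n) x <= be) -> (forall n, al <= Psi (g s n) x <= be) ->
    A u n `<=` W -> J s `&` W = set0 -> A u n `&` K s = set0.
  move=> Hu Hs AW JW; have AJ : A u n `&` J s = set0.
    by rewrite -subset0 => z [/AW Wz Jz]; rewrite -JW.
  case: (connected_avoids_fiber Hesc (level_curve_connected Hesc (w := u) (n := n)) AJ) => // H.
  by have := level_curve_not_sub_filled ber Hu Hs H.
have K1 : K v `<=` K w.
  apply: (@filled_julia_sub _ _ N1 z0) => // n /HN1 AU.
  exact: (out _ _ U).
have K2 : K w `<=` K v.
  apply: (@filled_julia_sub _ _ N2 z0) => // n /HN2 AV.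
  exact: (out _ _ V).
(* Both inclusions hold, so the two fibers coincide although they lie on different sides. *)
have KE : K w = K v by apply/seteqP.
have [y [Jy Uy]] := JwU.
have : (J v `&` U) y by split=> //; move: Jy; rewrite /fiber_julia KE.
by rewrite JvU.
Qed.

(* If the fibers of words [w'] approximating [w] avoided a disc centred at a point
   of [J w], Harnack's inequality would make the escape rates of [w'] comparable
   on this disc, but they tend to 0 at the centre and not at escaping points. *)
Lemma fiber_julia_semicontinuous (U V : set C) w z0 : (forall u, K u z0) ->
  open U -> open V -> U `&` V = set0 -> (forall u, J u `<=` U `|` V) ->
  (forall N, exists2 v, J v `&` U !=set0 & forall i, (i < N)%N -> v i = w i) ->
  J w `&` U !=set0.
Proof.
move=> K0 oU oV UV JUV Hv.
have [z Jz] := fiber_julia_nonempty Hesc (K0 w).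
have [Uz|Vz] := JUV w z Jz; first by exists z.
exfalso; have [Kz nint] := Jz.
have /nbhs_modulusP[d d0 Hd] := open_nbhs_nbhs (conj oV Vz).
(* [d / 16] is an eighth of the radius [d / 2] of the disc on which Harnack's inequality is
   applied. *)
have [y [yd nKy]] : exists y, nc (y - z) < d / 16 /\ ~ K w y.
  apply: contrapT => /forallNP H; apply: nint; apply/nbhs_modulusP.
  exists (d / 16); first by rewrite divr_gt0.
  by move=> y yd; apply: contrapT => nK; exact: (H y).
have [n0 Hn0] := not_filled_julia nKy.
have b1 := escape_b1 Hesc; have a1 := escape_a1 Hesc; have ar := escape_ar Hesc.
have a0 := escape_a0 Hesc.
have br : 0 <= b * r by rewrite mulr_ge0 ?(ltW r0) // (le_trans ler01).
(* The word [v] below follows [w] for [M] letters after [y] has escaped. With [e] the degree of the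
   rest of the composition [Q], this gives [|Q(y)| >= 2^(e 2^M)], while [|Q(z)| <= (b r)^e].
   Harnack's inequality then yields [2^(2^M) <= (b r)^2], which this [M] violates. *)
pose M := Num.bound ((b * r) ^+ 2).
have MB : (b * r) ^+ 2 < M%:R by apply: archi_boundP; rewrite exprn_ge0.
have [v JvU Hvw] := Hv (n0 + M)%N.
have JvV := fiber_julia_one_side Hesc oU oV UV (JUV v) JvU.
pose D := [set x : C | nc (x - z) <= d / 2].
have d2 : 0 < d / 2 by rewrite divr_gt0.
have DV : D `<=` V by move=> x Dx; apply: Hd; move: Dx d0; rewrite /D /= => ? ?; lra.
have DJ : D `&` J v = set0 by rewrite -subset0 => x [/DV Vx Jx]; rewrite -JvV.
have gvw k : (k <= n0 + M)%N -> g v k = g w k.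
  by move=> kM; apply: eq_word_comp => i ik; apply: Hvw; exact: leq_trans kM.
have Dy : D y by rewrite /D /=; move: yd d0 => ? ?; lra.
case: (connected_avoids_fiber Hesc (@disc_connected R z _ (ltW d2)) DJ) => DK.
  by have := DK y Dy n0; rewrite gvw ?leq_addr // ltNge Hn0.
have [N HN] := compact_escape (@compact_disc R z (d / 2)) DK.
pose Q := g v (n0 + M + N)%N.
have Q1 x : nc (x - z) <= d / 2 -> 1 <= nc Q.[x].
  by move=> Dx; apply: (le_trans r1); apply: HN => //; exact: leq_addl.
have := harnack (p := Q) (y := y) d2 Q1.
have -> : nc (y - z) <= d / 2 / 8 by move: yd => ?; lra.
move=> /(_ isT).
set e := deg (g (word_shift v (n0 + M)%N) N).
have e0 : (0 < e)%N by exact: (deg_word_comp_gt0 Hesc).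
have Qz : nc Q.[z] <= (b * r) ^+ e.
  have := word_comp_upper_bound Hesc (word_shift v (n0 + M)) N (g v (n0 + M)).[z].
  rewrite -horner_word_compD -/Q -/e => H.
  apply: (@le_trans _ _ (b * Num.max 1 (nc Q.[z]))).
    apply: (@le_trans _ _ (Num.max 1 (nc Q.[z]))); first by rewrite le_max lexx orbT.
    by rewrite ler_peMl // le_max ler01.
  apply: (le_trans H); apply: lerXn2r; rewrite ?nnegrE.
  - by rewrite mulr_ge0 ?(le_trans ler01 b1) // le_max ler01.
  - by rewrite mulr_ge0 ?(le_trans ler01 b1) ?(ltW r0).
  rewrite ler_pM2l ?(lt_le_trans ltr01 b1) // ge_max r1 /=.
  by rewrite gvw //; exact: ltW.
have Qy : 2 ^+ (e * 2 ^ M) <= nc Q.[y].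
  have rn0 : r <= nc (g v n0).[y] by rewrite gvw ?leq_addr.
  have [_ _] := word_comp_lower_bound Hesc (word_shift v n0) (M + N) rn0.
  rewrite -horner_word_compD addnA -/Q => H.
  apply: (@le_trans _ _ (a * nc Q.[y])); last by rewrite ler_piMl ?modulus_ge0.
  apply: le_trans H.
  apply: (@le_trans _ _ (2 ^+ deg (g (word_shift v n0) (M + N)%N))).
    apply: ler_weXn2l; first by rewrite ler1n.
    rewrite deg_word_compD; have -> : word_shift (word_shift v n0) M = word_shift v (n0 + M).
      by apply/funext => i; rewrite /word_shift addnA.
    by rewrite leq_mul2l -/e (deg_word_comp_ge Hesc) orbT.
  apply: lerXn2r; rewrite ?nnegrE ?mulr_ge0 ?modulus_ge0 ?(ltW a0) //.
  by apply: (le_trans ar); rewrite ler_pM2l.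
move=> H; have : (2 ^+ (2 ^ M)) ^+ e <= ((b * r) ^+ 2) ^+ e :> R.
  rewrite -!exprM mulnC; apply: (le_trans Qy); apply: (le_trans H).
  by rewrite mulnC exprM; apply: lerXn2r; rewrite ?nnegrE ?modulus_ge0 ?exprn_ge0 ?mulr_ge0 ?(ltW r0) ?(le_trans ler01 b1).
rewrite ler_pXn2r ?nnegrE ?exprn_ge0 // => H2.
have := le_lt_trans H2 MB; apply/negP; rewrite -leNgt.
rewrite -natrX ler_nat; apply: leq_trans (ltnW (@ltn_expl 2 M isT)) _.
exact/ltnW/ltn_expl.
Qed.

End Ordering.

(** * Normality and the Julia set *)

Section Normality.
Context {R : realType} {m : nat}.
Local Notation C := (cplx R).
Local Notation nc := (@Normc.normc R).
Implicit Types (x y z c : C) (w v u : nat -> 'I_m.+1) (s t : sphere R).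

Lemma sqrt1Dsqr_ge1 (k : R) : 1 <= Num.sqrt (1 + k ^+ 2).
Proof. by rewrite -{1}sqrtr1 ler_wsqrtr // lerDl sqr_ge0. Qed.

Lemma sqrt1Dsqr_ge (k : R) : `|k| <= Num.sqrt (1 + k ^+ 2).
Proof. by rewrite -sqrtr_sqr ler_wsqrtr // lerDr. Qed.

Lemma sqrt1Dsqr_le (k : R) : 0 <= k -> Num.sqrt (1 + k ^+ 2) <= 1 + k.
Proof.
move=> k0; have k1 : 0 <= 1 + k by rewrite addr_ge0.
rewrite -[leRHS]ger0_norm // -sqrtr_sqr ler_wsqrtr //.
by rewrite sqrrD expr1n mul1r -addrA lerD2l lerDr mulrn_wge0.
Qed.

Lemma chordal_finite_le x y : chordal (finite_pt x) (finite_pt y) <= 2 * nc (x - y).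
Proof.
rewrite /= ler_pdivrMr; last by rewrite mulr_gt0 // (lt_le_trans ltr01) // sqrt1Dsqr_ge1.
rewrite ler_peMr ?mulr_ge0 ?modulus_ge0 //.
by apply: mulr_ege1; exact: sqrt1Dsqr_ge1.
Qed.

Lemma chordal_infty_lt x (e : R) : 0 < e -> 2 / e < nc x -> chordal (finite_pt x) infty < e.
Proof.
move=> e0; rewrite ltr_pdivrMr // => H /=.
have s0 : 0 < Num.sqrt (1 + nc x ^+ 2) by rewrite (lt_le_trans ltr01) // sqrt1Dsqr_ge1.
rewrite ltr_pdivrMr // mulrC; apply: (lt_le_trans H).
rewrite ler_pM2r //; apply: le_trans (sqrt1Dsqr_ge _); exact: ler_norm.
Qed.

Lemma chordal_infty_bound x (B : R) : nc x <= B ->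
  2 / (1 + B) <= chordal (finite_pt x) infty.
Proof.
move=> xB; have B0 : 0 <= B by apply: le_trans xB; exact: modulus_ge0.
have s0 : 0 < Num.sqrt (1 + nc x ^+ 2) by rewrite (lt_le_trans ltr01) // sqrt1Dsqr_ge1.
rewrite /= ler_pM2l // lef_pV2 ?posrE // ?ltr_pwDl //.
by apply: (le_trans (sqrt1Dsqr_le (modulus_ge0 _))); rewrite lerD2l.
Qed.

Lemma chordal_finite_ge x y : 1 + 2 * nc y <= nc x ->
  2^-1 / (1 + nc y) <= chordal (finite_pt x) (finite_pt y).
Proof.
move=> xy; have y0 := modulus_ge0 y; have x1 : 1 <= nc x by move: xy => ?; lra.
have y1 : 0 < 1 + nc y by rewrite ltr_pwDl.
have sx : 0 < Num.sqrt (1 + nc x ^+ 2) by rewrite (lt_le_trans ltr01) // sqrt1Dsqr_ge1.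
have sy : 0 < Num.sqrt (1 + nc y ^+ 2) by rewrite (lt_le_trans ltr01) // sqrt1Dsqr_ge1.
rewrite /= ler_pdivlMr ?mulr_gt0 // mulrAC ler_pdivrMr //.
have h1 : nc x / 2 <= nc (x - y) by apply: le_trans (modulusB_ge x y); move: xy => ?; lra.
have h2 := sqrt1Dsqr_le (modulus_ge0 x); have h3 := sqrt1Dsqr_le y0.
apply: (@le_trans _ _ (2^-1 * ((2 * nc x) * (1 + nc y)))).
  rewrite ler_pM2l ?invr_gt0 // ler_pM ?(ltW sx) ?(ltW sy) //.
  by apply: (le_trans h2); move: x1 => ?; lra.
by rewrite mulrA ler_pM2r //; move: h1 => ?; lra.
Qed.

Lemma subsequence (P : nat -> nat -> Prop) :
  (forall k n0, exists2 n, (n0 <= n)%N & P k n) ->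
  exists phi : nat -> nat, {homo phi : i j / (i < j)%N} /\ forall k, P k (phi k).
Proof.
move=> H; have H' (kn : nat * nat) : exists n, (kn.2 <= n)%N /\ P kn.1 n.
  by have [n h1 h2] := H kn.1 kn.2; exists n.
have [f Hf] := choice H'.
pose phi := fix phi k := if k is k'.+1 then f (k'.+1, (phi k').+1) else f (0%N, 0%N).
exists phi; split; last by case=> [|k]; [exact: (Hf (0, 0)%N).2|exact: (Hf (k.+1, (phi k).+1)).2].
apply: homo_ltn => [|k]; first exact: ltn_trans.
exact: (Hf (k.+1, (phi k).+1)).1.
Qed.

Lemma infinite_pigeonhole (T : finType) (f : nat -> T) :
  exists t : T, forall n0, exists2 n, (n0 <= n)%N & f n = t.
Proof.
apply: contrapT => /forallNP H.
have {}H (t : T) : exists n0, forall n, (n0 <= n)%N -> f n <> t.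
  have := H t => /existsNP [n0 Hn0]; exists n0 => n nn0 fn; apply: Hn0; exists n => //.
have [N HN] := choice H; pose M := (\max_(t : T) N t)%N.
by apply: (HN (f M) M) => //; exact: (@leq_bigmax T N (f M)).
Qed.

Lemma ultra_limit (F : set_system nat) (f : nat -> C) (B : R) : UltraFilter F ->
  F [set n | nc (f n) <= B] -> exists z, forall e, 0 < e -> F [set n | nc (f n - z) < e].
Proof.
move=> FU FB; have cB := @compact_disc R 0 B.
have FD : F (f @^-1` [set z : C | nc (z - 0) <= B]).
  by apply: filterS FB => n /= fn; rewrite subr0.
have [|z [_ clz]] := cB (f @ F) _; first exact: FD.
exists z => e e0; have [//|nF] := in_ultra_setVsetC [set n | nc (f n - z) < e] FU.
have nF' : F (f @^-1` [set x | e <= nc (x - z)]).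
  by apply: filterS nF => n /= /negP; rewrite -leNgt.
have [x [/= h1 h2]] := clz _ _ nF' (nbhs_modulus z e0).
by move: h1; rewrite leNgt h2.
Qed.

(* Convergence along a free ultrafilter replaces the diagonal argument in the
   Arzela-Ascoli theorem. *)
Lemma bounded_polys_subsequence (p : nat -> {poly R[i]}) c (d B : R) n0 : 0 < d ->
  (forall n z, (n0 <= n)%N -> nc (z - c) <= d -> nc (p n).[z] <= B) ->
  exists (phi : nat -> nat) (L : C -> C), {homo phi : i j / (i < j)%N} /\
    forall k z, nc (z - c) <= d / 2 -> nc ((p (phi k)).[z] - L z) < k.+1%:R^-1.
Proof.
move=> d0 HB; have [F [FU ooF]] := ultraFilterLemma (eventually_filter : ProperFilter \oo).
have FP : ProperFilter F := ultra_proper.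
have FF : Filter F := filter_filter.
have Fge N : F [set n | (N <= n)%N] by apply: ooF; exists N.
pose D := [set z : C | nc (z - c) <= d / 2].
have DB n z : (n0 <= n)%N -> D z -> nc (p n).[z] <= B.
  by move=> nn0 Dz; apply: HB => //; apply: (le_trans Dz); move: d0 => ?; lra.
have B0 : 0 <= B.
  have Dc : D c by rewrite /D /= subrr modulus0 divr_ge0 // ltW.
  by apply: le_trans (DB n0 c (leqnn _) Dc); exact: modulus_ge0.
have lim z : exists l, D z -> forall e, 0 < e -> F [set n | nc ((p n).[z] - l) < e].
  have [Dz|nDz] := pselect (D z); last by exists 0.
  have [|l Hl] := @ultra_limit F (fun n => (p n).[z]) B FU; last by exists l.
  by apply: filterS (Fge n0) => n /= nn0; exact: DB.
have [L HL] := choice lim.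
pose M := 4 * B / d; have M0 : 0 <= M by rewrite divr_ge0 ?mulr_ge0 // ltW.
have lip n x y : (n0 <= n)%N -> D x -> D y -> nc ((p n).[x] - (p n).[y]) <= M * nc (x - y).
  by move=> nn0 Dx Dy; apply: (@bounded_horner_lipschitz _ _ c) => // z; exact: HB.
have Llip x y : D x -> D y -> nc (L x - L y) <= M * nc (x - y).
  move=> Dx Dy; apply/ler_addgt0Pr => e e0.
  have e2 : 0 < e / 2 by rewrite divr_gt0.
  have [n [[/= hx hy] /= nn0]] := filter_ex (filterI (filterI (HL x Dx _ e2) (HL y Dy _ e2)) (Fge n0)).
  have := modulus_triangle (L x) (p n).[x] (L y); have := modulus_triangle (p n).[x] (p n).[y] (L y).
  have := lip n x y nn0 Dx Dy; rewrite (modulus_distC (L x) (p n).[x]).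
  by move: hx hy => ? ? ? ? ?; lra.
(* Pointwise convergence along [F] becomes uniform by compactness of the disc and the common
   Lipschitz constant [M]. *)
have unif e : 0 < e -> F [set n | forall z, D z -> nc ((p n).[z] - L z) < e].
  move=> e0; have /compact_near_coveringP/near_covering_withinP cov := @compact_disc R c (d / 2).
  apply: (cov _ F (fun n z => nc ((p n).[z] - L z) < e)) => z Dz.
  have e3 : 0 < e / 3 by rewrite divr_gt0.
  have M1 : 0 < M + 1 by rewrite ltr_wpDl.
  have r0 : 0 < e / 3 / (M + 1) by rewrite divr_gt0.
  exists ([set z' : C | nc (z' - z) < e / 3 / (M + 1)],
    [set n | nc ((p n).[z] - L z) < e / 3] `&` [set n | (n0 <= n)%N]).
    by split; [exact: nbhs_modulus|exact: filterI (HL z Dz _ e3) (Fge n0)].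
  move=> [z' n] /= [z'z [hn nn0]] Dz'.
  have Mz : M * nc (z' - z) <= e / 3.
    move: z'z; rewrite ltr_pdivlMr // => /ltW; apply: le_trans.
    by rewrite mulrC ler_wpM2l ?modulus_ge0 // lerDl.
  have := modulus_triangle (p n).[z'] (p n).[z] (L z'); have := modulus_triangle (p n).[z] (L z) (L z').
  have := lip n z' z nn0 Dz' Dz; have := Llip z z' Dz Dz'; rewrite (modulus_distC z z').
  by move: hn Mz => ? ? ? ? ? ?; lra.
have [|phi [phi_mono Hphi]] := @subsequence (fun k n => forall z, D z -> nc ((p n).[z] - L z) < k.+1%:R^-1).
  move=> k N; have k0 : 0 < k.+1%:R^-1 :> R by rewrite invr_gt0 ltr0n.
  by have [n [h1 h2]] := filter_ex (filterI (unif _ k0) (Fge N)); exists n.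
by exists phi, L; split=> // k z Dz; exact: Hphi.
Qed.

Lemma converges_to_infinity (q : nat -> sphere R -> sphere R) (phi : nat -> nat) (U : set (sphere R)) :
  (forall k s, U s -> q (phi k) s = infty \/ exists2 z, q (phi k) s = finite_pt z & k%:R < nc z) ->
  forall K : set (sphere R), compact K -> K `<=` U -> forall e : R, 0 < e ->
  \forall n \near \oo, forall s, K s -> chordal (q (phi n) s) (cst infty s) < e.
Proof.
move=> H K _ KU e e0; exists (Num.bound (2 / e)) => // n /= en s /KU /(H n) [->|[z -> nz]] //.
apply: chordal_infty_lt => //; apply: le_lt_trans nz; apply: ltW.
apply: lt_le_trans (archi_boundP _) _; first by rewrite divr_ge0 // ltW.
by rewrite ler_nat.
Qed.

Context {h : 'I_m.+1 -> {poly R[i]}} {a b r : R}.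
Context (Hesc : escape_constants h a b r).
Local Notation g w n := (word_comp h w n).
Local Notation K := (@filled_julia R m h r).
Local Notation J := (@fiber_julia R m h r).
Local Notation G := (generated (range h)).

Lemma semigroup_maps_words (q : nat -> sphere R -> sphere R) :
  (forall n, semigroup_maps G (q n)) ->
  exists (w : nat -> nat -> 'I_m.+1) (l : nat -> nat), forall n, q n = sphere_map (g (w n) (l n)).
Proof.
move=> H; have H' n : exists wl : (nat -> 'I_m.+1) * nat, q n = sphere_map (g wl.1 wl.2).
  have [p /generated_is_word_comp [w [l ->]] <-] := H n.
  by exists (w, l).
have [f Hf] := choice H'.
by exists (fun n => (f n).1), (fun n => (f n).2).
Qed.

Lemma sphere_map_infty w n : sphere_map (g w n) infty = infty.
Proof. by rewrite /= (deg_word_comp_gt0 Hesc). Qed.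

(** Beyond radius [r] a word of length [l] multiplies moduli by at least [2^l]. If the lengths are
    unbounded, a subsequence tends to infinity; otherwise finitely many compositions occur from some
    index on, and a subsequence is constant. *)
Lemma fatou_infty : fatou_set G infty.
Proof.
pose U : set (sphere R) := Some @` (~` [set z : C | nc (z - 0) <= r]) `|` [set None].
have oU : open U.
  rewrite openE => -[z|] Uz.
    have {Uz} zr : r < nc z.
      by case: Uz => [[z' /= /negP + [<-]]|//]; rewrite subr0 -ltNge.
    have oD : open [set z : C | r < nc z] by exact/open_superlevel/modulus_continuous.
    have nD := @one_point_compactification_some_nbhs C z _ (open_nbhs_nbhs (conj oD zr)).
    apply: (@filterS _ (nbhs (Some z : sphere R)) _ _ U _ nD).
    by move=> _ [z' /= z'r <-]; left; exists z' => //=; rewrite subr0; apply/negP; rewrite -ltNge.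
  exists [set z : C | nc (z - 0) <= r] => //; split; first exact: compact_disc.
  exact/closed_sublevel/modulus_dist_continuous.
exists U; split=> //; first by right.
move=> q /semigroup_maps_words [w [l Eq]].
have grow n s : U s -> q n s = infty \/
    exists2 z, q n s = finite_pt z & 2 ^+ l n * r <= nc z.
  rewrite Eq => -[[z /= /negP + <-]|->]; last by left; exact: sphere_map_infty.
  rewrite subr0 -ltNge => rz; right; exists (g (w n) (l n)).[z] => //.
  have [_ H _] := word_comp_lower_bound Hesc (w n) (l n) (ltW rz).
  by apply: le_trans H; rewrite ler_pM2l ?exprn_gt0 // ltW.
have [long|short] := pselect (forall k n0, exists2 n, (n0 <= n)%N & (k <= l n)%N).
  have [phi [phi_mono Hphi]] := subsequence long.
  exists phi, (cst infty); split=> //; apply: (@converges_to_infinity _ _ U) => k s /(grow (phi k)).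
  case=> [->|[z -> Hz]]; [by left|right; exists z => //].
  apply: lt_le_trans Hz; apply: (@lt_le_trans _ _ (2 ^+ l (phi k))).
    rewrite -natrX ltr_nat; apply: leq_ltn_trans (Hphi k) _; exact: ltn_expl.
  by rewrite ler_peMr ?exprn_ge0 // (escape_r1 Hesc).
have [k [n0 Hk]] : exists k n0, forall n, (n0 <= n)%N -> (l n < k)%N.
  move: short => /existsNP [k /existsNP [n0 Hn0]]; exists k, n0 => n nn0.
  by rewrite ltnNge; apply/negP => kl; apply: Hn0; exists n.
(* A word of length below [k] is encoded in a finite type by its first [k] letters and its length;
   [inord] is faithful for indices from [n0] on. *)
have [[t L] Ht] := @infinite_pigeonhole ({ffun 'I_k -> 'I_m.+1} * 'I_k.+1)%type
  (fun n => ([ffun i : 'I_k => w n i], inord (l n))).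
pose v i := if insub i is Some j then t j else ord0.
have [phi [phi_mono Hphi]] : exists phi : nat -> nat, {homo phi : i j / (i < j)%N} /\
    forall j, g (w (phi j)) (l (phi j)) = g v L.
  apply: (@subsequence (fun _ n => g (w n) (l n) = g v L)) => _ n1.
  have [n nn [Et EL]] := Ht (maxn n0 n1); move: nn; rewrite geq_max => /andP[nn0 nn1].
  exists n => //; have lk := Hk n nn0.
  have -> : L = l n :> nat by rewrite -EL inordK // ltnW // ltnS ltnW.
  apply: eq_word_comp => i il; rewrite /v.
  by rewrite (insubT (fun i => i < k)%N (ltn_trans il lk)) -Et ffunE.
exists phi, (sphere_map (g v L)); split=> // K' _ _ e e0; exists 0%N => // n _ s _.
rewrite Eq Hphi; case: (sphere_map _ s) => [z|] //=.
by rewrite subrr modulus0 mulr0 mul0r.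
Qed.

(* Harnack's inequality for [g_v o g_u], where [v] is any word making this
   composition large on the disc. *)
Lemma semigroup_local_bound c (d B : R) : 0 < d -> 1 <= B ->
  (forall w, [set z | nc (z - c) <= d] `&` J w = set0) ->
  exists B' : R, forall u n z y, nc (z - c) <= d / 32 -> nc (y - c) <= d / 32 ->
    nc (g u n).[z] <= B -> nc (g u n).[y] <= B'.
Proof.
move=> d0 B1 DJ; have a0 := escape_a0 Hesc; have b1 := escape_b1 Hesc.
have b0 : 0 < b := lt_le_trans ltr01 b1.
exists (Num.max r ((b * B) ^+ 2 / a)) => u n z y zc yc zB.
have dge : 0 <= d := ltW d0.
have Dy : nc (y - c) <= d by move: yc => ?; lra.
have [yr|yr] := leP (nc (g u n).[y]) r; first by rewrite le_max yr.
case: (connected_avoids_fiber Hesc (@disc_connected R c _ dge) (DJ u)) => DK.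
  by have := DK y Dy n; rewrite ltNge (ltW yr).
have [N HN] := compact_escape Hesc (@compact_disc R c d) DK.
pose Q := g u (n + N)%N.
have d2 : 0 < d / 2 by rewrite divr_gt0.
have Q1 x : nc (x - z) <= d / 2 -> 1 <= nc Q.[x].
  move=> xz; apply: (le_trans (escape_r1 Hesc)); apply: HN; first exact: leq_addl.
  by have := modulus_triangle x z c; rewrite /=; move: xz zc dge => ? ? ? ?; lra.
have := harnack (p := Q) (y := y) d2 Q1.
(* The origin of [d / 32]: two points that close to [c] are within [d / 16] of each other. *)
have -> : nc (y - z) <= d / 2 / 8.
  by have := modulus_triangle y c z; rewrite (modulus_distC c z); move: zc yc => ? ? ?; lra.
move=> /(_ isT).
set e := deg (g (word_shift u n) N).
have e0 : (0 < e)%N by exact: (deg_word_comp_gt0 Hesc).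
have bB0 : 0 <= b * B by rewrite mulr_ge0 ?(ltW b0) // (le_trans ler01).
have Qz : nc Q.[z] <= (b * B) ^+ e.
  have := word_comp_upper_bound Hesc (word_shift u n) N (g u n).[z].
  rewrite -horner_word_compD -/Q -/e => H.
  apply: (@le_trans _ _ (b * Num.max 1 (nc Q.[z]))).
    apply: (@le_trans _ _ (Num.max 1 (nc Q.[z]))); first by rewrite le_max lexx orbT.
    by rewrite ler_peMl // le_max ler01.
  apply: (le_trans H); apply: lerXn2r; rewrite ?nnegrE //.
    by rewrite mulr_ge0 ?(ltW b0) // le_max ler01.
  by rewrite ler_pM2l // ge_max B1.
have [_ _] := word_comp_lower_bound Hesc (word_shift u n) N (ltW yr).
rewrite -horner_word_compD -/Q -/e => Qy H.
have : (a * nc (g u n).[y]) ^+ e <= ((b * B) ^+ 2) ^+ e.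
  apply: (le_trans Qy); apply: (@le_trans _ _ (nc Q.[y])).
    by rewrite ler_piMl ?modulus_ge0 // (escape_a1 Hesc).
  apply: (le_trans H); rewrite -exprM mulnC exprM.
  by apply: lerXn2r; rewrite ?nnegrE ?modulus_ge0 ?exprn_ge0.
have s1 : 0 <= a * nc (g u n).[y] by rewrite mulr_ge0 ?modulus_ge0 ?(ltW a0).
have s2 : 0 <= (b * B) ^+ 2 by rewrite exprn_ge0.
rewrite ler_pXn2r ?nnegrE //.
by rewrite mulrC -ler_pdivlMr // le_max => ->; rewrite orbT.
Qed.

(** Either a subsequence tends to infinity uniformly on the disc, or each late polynomial is bounded
    by [k] somewhere on it, and [semigroup_local_bound] makes the family uniformly bounded. Hence
    finite points of the Julia set are limits of points of fibers. *)
Lemma fatou_off_fibers c (d : R) : 0 < d ->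
  (forall w, [set z | nc (z - c) <= d] `&` J w = set0) -> fatou_set G (finite_pt c).
Proof.
move=> d0 DJ; pose d' := d / 32; have d'0 : 0 < d' by rewrite divr_gt0.
pose U : set (sphere R) := Some @` [set z : C | nc (z - c) < d' / 2].
have d2 : 0 < d' / 2 by rewrite divr_gt0.
exists U; split.
- apply: one_point_compactification_open_some.
  exact/open_sublevel/modulus_dist_continuous.
- by exists c => //=; rewrite subrr modulus0.
move=> q /semigroup_maps_words [w [l Eq]].
pose p n := g (w n) (l n).
have [big|small] := pselect (forall k n0 : nat, exists2 n, (n0 <= n)%N &
    forall z, nc (z - c) <= d' -> k%:R < nc (p n).[z]).
  have [phi [phi_mono Hphi]] := subsequence big.
  exists phi, (cst infty); split=> //; apply: (@converges_to_infinity _ _ U) => k _ [z zc <-].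
  right; exists (p (phi k)).[z]; first by rewrite Eq.
  by apply: Hphi; apply: (le_trans (ltW zc)); move: d'0 => ?; lra.
have [k [n0 Hk]] : exists k n0 : nat, forall n, (n0 <= n)%N ->
    exists2 z, nc (z - c) <= d' & nc (p n).[z] <= k%:R.
  move: small => /existsNP [k /existsNP [n0 Hn0]]; exists k, n0 => n nn0.
  apply: contrapT => H; apply: Hn0; exists n => // z zc.
  by rewrite ltNge; apply/negP => zk; apply: H; exists z.
have k1 : 1 <= k.+1%:R :> R by rewrite ler1n.
have [B HB] := semigroup_local_bound d0 k1 DJ.
have [|phi [L [phi_mono HL]]] := @bounded_polys_subsequence p c d' B n0 d'0.
  move=> n y nn0 yc; have [z zc zk] := Hk n nn0.
  by apply: (HB _ _ z) => //; apply: (le_trans zk); rewrite ler_nat.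
exists phi, (fun s => if s is Some z then finite_pt (L z) else infty); split=> //.
move=> K' _ K'U e e0; exists (Num.bound (2 / e)) => // n /= en s /K'U [z zc <-].
rewrite Eq; apply: (le_lt_trans (chordal_finite_le _ _)).
rewrite -ltr_pdivlMl //; apply: lt_le_trans (HL n z (ltW zc)) _.
rewrite -[leRHS]invrK lef_pV2 ?posrE ?ltr0n ?invr_gt0 ?mulr_gt0 ?invr_gt0 //.
rewrite invfM invrK; apply: ltW; apply: (lt_le_trans (archi_boundP _)).
  by rewrite divr_ge0 // ltW.
by rewrite ler_nat; exact: leqW.
Qed.

(* Near [z] there are points with bounded and points with unbounded orbit. *)
Lemma fiber_julia_sub_julia w z : J w z -> julia_set G (finite_pt z).
Proof.
move=> [Kz nint] [U [oU Uz nF]].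
have [|phi [f [phi_mono Hf]]] := nF (fun n => sphere_map (g w n.+1)).
  by move=> n; exists (g w n.+1) => //; exact: generated_word_comp.
have r1 := escape_r1 Hesc; have r0 : 0 < r := lt_le_trans ltr01 r1.
have /nbhs_modulusP[d d0 Hd] : nbhs z [set y : C | U (Some y)].
  exact: (@one_point_compactification_some_continuous C z U (open_nbhs_nbhs (conj oU Uz))).
pose D := [set y : C | nc (y - z) <= d / 2].
have d2 : 0 < d / 2 by rewrite divr_gt0.
have cD : compact (Some @` D : set (sphere R)).
  apply: continuous_compact; last exact: compact_disc.
  exact/continuous_subspaceT/one_point_compactification_some_continuous.
have DU : Some @` D `<=` U.
  by move=> _ [y Dy <-]; apply: Hd; move: Dy d0; rewrite /D /= => ? ?; lra.
have phi_ge n : (n <= phi n)%N.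
  by elim: n => // n /leq_ltn_trans; apply; exact: phi_mono.
(* At an escaping point the only possible limit is infinity: a finite limit would stay at a positive
   chordal distance from the large values. *)
have fy y : D y -> ~ K w y -> f (Some y) = infty.
  move=> Dy /not_filled_julia [n1 Hn1].
  case Efy: (f (Some y)) => [x|] //; exfalso.
  have e0 : 0 < 2^-1 / (1 + nc x) by rewrite divr_gt0 ?invr_gt0 // ltr_pwDl ?modulus_ge0.
  have [N _ HN] := Hf _ cD DU _ e0.
  pose M := (maxn N (n1 + Num.bound (1 + 2 * nc x)))%N.
  have := HN M (leq_maxl _ _) (Some y); rewrite Efy => /(_ (ex_intro2 _ _ y Dy erefl)).
  apply/negP; rewrite -leNgt; apply: chordal_finite_ge.
  have nM : (n1 + Num.bound (1 + 2 * nc x) <= (phi M).+1)%N.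
    by apply: leqW; apply: leq_trans (phi_ge M); exact: leq_maxr.
  pose bd := Num.bound (1 + 2 * nc x).
  pose j := (bd + ((phi M).+1 - (n1 + bd)))%N.
  have jb : (bd <= j)%N by exact: leq_addr.
  have -> : (phi M).+1 = (n1 + j)%N by rewrite /j addnA subnKC.
  apply: le_trans (escape_forever Hesc j Hn1).
  apply: ltW; apply: (lt_le_trans (archi_boundP _)).
    by rewrite addr_ge0 ?mulr_ge0 ?modulus_ge0.
  apply: (@le_trans _ _ j%:R); first by rewrite ler_nat.
  apply: (@le_trans _ _ (2 ^+ j)); last by rewrite ler_peMr ?exprn_ge0.
  by rewrite -natrX ler_nat ltnW // ltn_expl.
(* Values of modulus at most [r + 1] have at least this chordal distance from infinity. By
   continuity some escaping [y] near [z] still has such a value at stage [N], where it should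
   already be closer to its limit infinity. *)
have e0 : 0 < 2 / (1 + (r + 1)) by rewrite divr_gt0 // addr_gt0 // addr_gt0.
have [N _ HN] := Hf _ cD DU _ e0.
have [d1 d10 Hd1] := @horner_continuity R (g w (phi N).+1) z 1 ltr01.
have [y [yd nKy]] : exists y, nc (y - z) < Num.min d1 (d / 2) /\ ~ K w y.
  apply: contrapT => /forallNP H; apply: nint; apply/nbhs_modulusP.
  exists (Num.min d1 (d / 2)); first by rewrite lt_min d10.
  by move=> y yd; apply: contrapT => nK; exact: (H y).
move: yd; rewrite lt_min => /andP[/Hd1 gy yd].
have Dy : D y := ltW yd.
have := HN N (leqnn _) (Some y) (ex_intro2 _ _ y Dy erefl).
rewrite (fy y Dy nKy); apply/negP; rewrite -leNgt; apply: chordal_infty_bound.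
have := modulusD ((g w (phi N).+1).[y] - (g w (phi N).+1).[z]) (g w (phi N).+1).[z].
rewrite subrK => /le_trans; apply; rewrite addrC; apply: lerD; last exact: ltW.
exact: ltW (Kz _).
Qed.

End Normality.

(** * Escape constants and itineraries *)

Section Constants.
Context {R : realType}.
Local Notation C := (cplx R).
Local Notation nc := (@Normc.normc R).
Implicit Types (x y z c : C) (p : {poly R[i]}).

Lemma critical_point_poly p c : p^`().[c] = 0 -> critical_point (sphere_map p) (finite_pt c).
Proof.
move=> pc; rewrite /critical_point /=.
have [M M0 HM] := horner_taylor2 p c.
set f := fun w : C => _.
have lim : (fun k : C => k^-1 *: (f (k *: (1 : C) + 0) - f 0) : C) @ (0 : C)^' --> (0 : C).
  move=> A /nbhs_modulusP[e e0 He].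
  have M1 : 0 < M + 1 by rewrite ltr_wpDl.
  have e1 : 0 < Num.min 1 (e / (M + 1)) by rewrite lt_min ltr01 divr_gt0.
  apply: filterS (nbhs_modulus (0 : C) e1) => k; rewrite /= subr0 lt_min => /andP[k1 ke] k0.
  apply: He; rewrite subr0 /f !addr0 subrr subr0.
  have -> : k *: (1 : C) = k by exact: mulr1.
  rewrite modulusM modulusV.
  have nk : 0 < nc k by rewrite modulus_gt0.
  have := HM c k; rewrite subrr modulus0 pc mulr0 subr0 => /(_ ler01 (ltW k1)) H.
  rewrite ltr_pdivrMl //; apply: (le_lt_trans H); rewrite expr2 mulrCA.
  rewrite ltr_pM2l //; move: ke; rewrite ltr_pdivlMr // mulrC; apply: le_lt_trans.
  by rewrite ler_wpM2r ?modulus_ge0 // lerDl.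
split; first by apply/cvg_ex; exists 0; exact: lim.
exact: (cvg_lim _ lim).
Qed.

Lemma bounded_set_modulus (A : set C) : bounded_set A -> exists B : R, forall z, A z -> nc z <= B.
Proof.
move=> [M [/complex_realP [k ->] HM]]; exists (k + 1) => z Az.
have := HM ((k + 1)%:C)%C; rewrite ltcR ltrDl ltr01 => /(_ isT z Az) H.
by rewrite -lecR; exact: H.
Qed.

Lemma horner_upper_bound p : exists2 B : R, 1 <= B &
  forall z, nc p.[z] <= B * Num.max 1 (nc z) ^+ deg p.
Proof.
exists (1 + \sum_(i < size p) nc p`_i) => [|z].
  by rewrite lerDl sumr_ge0 // => i _; exact: modulus_ge0.
have M1 : 1 <= Num.max 1 (nc z) by rewrite le_max lexx.
rewrite horner_coef; apply: (le_trans (modulus_sum _ _ _)).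
rewrite mulrDl mulr_suml; apply: ler_wpDl.
  by rewrite mul1r exprn_ge0 // (le_trans ler01).
apply: ler_sum => i _; rewrite modulusM modulusX ler_wpM2l ?modulus_ge0 //.
apply: (@le_trans _ _ (Num.max 1 (nc z) ^+ i)).
  by apply: lerXn2r; rewrite ?nnegrE ?modulus_ge0 ?(le_trans ler01) // le_max lexx orbT.
apply: ler_weXn2l => //.
by rewrite /deg -ltnS (ltn_predK (ltn_ord i)).
Qed.

Lemma horner_lower_bound p : p != 0 -> exists a s : R, [/\ 0 < a, 0 <= s &
  forall z, s <= nc z -> a * nc z ^+ deg p <= nc p.[z]].
Proof.
move=> p0; pose A := \sum_(i < deg p) nc p`_i.
have A0 : 0 <= A by apply: sumr_ge0 => i _; exact: modulus_ge0.
have l0 : 0 < nc (lead_coef p) by rewrite modulus_gt0 lead_coef_eq0.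
exists (nc (lead_coef p) / 2), (1 + 2 * A / nc (lead_coef p)); split.
- by rewrite divr_gt0.
- by rewrite addr_ge0 // divr_ge0 ?mulr_ge0 // ltW.
move=> z Hz; have z1 : 1 <= nc z.
  by apply: le_trans Hz; rewrite lerDl divr_ge0 ?mulr_ge0 // ltW.
have zA : 2 * A <= nc (lead_coef p) * nc z.
  by rewrite [leRHS]mulrC -ler_pdivrMr //; apply: le_trans Hz; rewrite lerDr.
have sp : size p = (deg p).+1 by rewrite /deg prednK // size_poly_gt0.
rewrite horner_coef sp big_ord_recr /= addrC.
apply: le_trans (modulusD_ge _ _); rewrite modulusM modulusX.
have -> : p`_(deg p) = lead_coef p by [].
have low : nc (\sum_(i < deg p) p`_i * z ^+ i) <= nc (lead_coef p) / 2 * nc z ^+ deg p.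
  apply: (le_trans (modulus_sum _ _ _)).
  case Ed : (deg p) A0 zA => [|d] A0 zA.
    by rewrite big_ord0 expr0 mulr1 divr_ge0 // ltW.
  apply: (@le_trans _ _ (A * nc z ^+ d)); last first.
    rewrite exprS mulrA ler_wpM2r ?exprn_ge0 ?modulus_ge0 //.
    by move: zA => ?; lra.
  rewrite /A Ed mulr_suml; apply: ler_sum => i _.
  rewrite modulusM modulusX ler_wpM2l ?modulus_ge0 //.
  by apply: ler_weXn2l => //; rewrite -ltnS.
by move: low => ?; lra.
Qed.

End Constants.

Section MainTheorem.
Context {R : realType} {m : nat}.
Local Notation C := (cplx R).
Local Notation nc := (@Normc.normc R).
Implicit Types (x y z c : C) (h : 'I_m.+1 -> {poly R[i]}) (w v u : nat -> 'I_m.+1).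

Lemma exists_escape_constants h (B : R) : postcritically_bounded (generated (range h)) ->
  exists a b r : R, escape_constants h a b r /\ B <= r.
Proof.
move=> [_ degG /bounded_set_modulus [P HP]].
have hdeg j : (2 <= deg (h j))%N by apply: degG; apply: generated_gen; exists j.
have hn0 j : h j != 0.
  by rewrite -size_poly_gt0; have := hdeg j; rewrite /deg; case: size.
have [b Hb] := choice (fun j => let: ex_intro2 b h1 h2 := horner_upper_bound (h j) in
  ex_intro (fun b => 1 <= b /\ _) b (conj h1 h2)).
have [f Hf] := choice (fun j => let: ex_intro a (ex_intro s H) := horner_lower_bound (hn0 j) in
  ex_intro (fun f : R * R => [/\ 0 < f.1, 0 <= f.2 & forall z, f.2 <= nc z ->
     f.1 * nc z ^+ deg (h j) <= nc (h j).[z]]) (a, s) H).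
(* Sums over the generators replace maxima and, through inverses, minima. *)
pose a' := 1 + \sum_j (f j).1^-1.
have fa j : 0 < (f j).1 by have [] := Hf j.
have fs j : 0 <= (f j).2 by have [] := Hf j.
have a'1 : 1 <= a' by rewrite lerDl sumr_ge0 // => j _; rewrite invr_ge0 ltW.
have a'0 : 0 < a' := lt_le_trans ltr01 a'1.
pose b' := \sum_j b j.
have b'ge j : b j <= b'.
  rewrite /b' (bigD1 j) //= lerDl sumr_ge0 // => i _.
  by apply: (le_trans ler01); case: (Hb i).
pose S := \sum_j (f j).2.
have Sge j : (f j).2 <= S by rewrite /S (bigD1 j) //= lerDl sumr_ge0.
have S0 : 0 <= S by apply: sumr_ge0.
pose r := 2 * a' + S + `|P| + `|B| + 1.
have rP : P < r by have := ler_norm P; have := normr_ge0 B; rewrite /r => ? ?; lra.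
have rB : B <= r by have := ler_norm B; have := normr_ge0 P; rewrite /r => ? ?; lra.
have rS : S <= r by have := normr_ge0 P; have := normr_ge0 B; rewrite /r => ? ?; lra.
have ra : 2 * a' <= r by have := normr_ge0 P; have := normr_ge0 B; rewrite /r => ? ?; lra.
exists a'^-1, b', r; split=> //; split=> //.
- by rewrite invr_gt0.
- by rewrite invf_le1.
- by apply: le_trans (b'ge ord0); case: (Hb ord0).
- by apply: le_trans ra; move: a'1 => ?; lra.
- by rewrite mulrC ler_pdivlMr.
- move=> j z; have [b1 /(_ z) H] := Hb j; apply: (le_trans H).
  by rewrite ler_wpM2r // exprn_ge0 // le_max ler01.
- move=> j z rz; have [_ _ /(_ z)] := Hf j.
  move=> /(_ (le_trans (Sge j) (le_trans rS rz))); apply: le_trans.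
  rewrite ler_wpM2r ?exprn_ge0 ?modulus_ge0 // -[leRHS]invrK lef_pV2 ?posrE ?invr_gt0 //.
  apply: (@le_trans _ _ (\sum_j (f j).1^-1)); last by rewrite /a' lerDr.
  by rewrite (bigD1 j) //= lerDl sumr_ge0 // => i _; rewrite invr_ge0 ltW.
(* The empty word gives the identity, which has no critical point; all other words belong to the
   semigroup. *)
move=> w [|n] z; first by rewrite /= derivX hornerC => /eqP; rewrite oner_eq0.
move=> /critical_point_poly crit; apply: le_lt_trans rP; apply: HP.
rewrite /finite_postcritical_set /postcritical_set /=.
apply: subset_closure; exists (word_comp h w n.+1); first exact: generated_word_comp.
by exists (finite_pt z).
Qed.

(** The point is a critical value of one generator. Under any further word it goes to a critical
    value of the longer composition, hence to modulus less than [r]. *)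
Lemma exists_common_point h (a b r : R) : escape_constants h a b r ->
  exists z, forall w, @filled_julia R m h r w z.
Proof.
move=> Hesc; have hdeg := escape_deg Hesc ord0.
have : size (h ord0)^`() != 1%N.
  case Ed : (deg (h ord0)) hdeg => [//|[//|d]] _.
  have : ((h ord0)^`())`_d.+1 != 0.
    rewrite coef_deriv mulrn_eq0 /= -Ed lead_coef_eq0.
    by apply: contraPneq Ed => ->; rewrite /deg size_poly0.
  by apply: contraNneq => s1; rewrite nth_default // s1.
move=> /closed_rootP [c /rootP crit]; exists (h ord0).[c] => w n.
have := escape_critical Hesc (w := word_cat (fun=> ord0) 1 w) (n := (1 + n)%N) (z := c).
rewrite word_comp_cat /= comp_polyXr deriv_comp hornerM crit mulr0 horner_comp.
exact.
Qed.

Lemma alpha_le_fixpoint h j : alpha h <= Psi_fixpoint (h j).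
Proof. by apply: bigmin_le_cond. Qed.

Lemma fixpoint_le_beta h j : Psi_fixpoint (h j) <= beta h.
Proof. by apply: le_bigmax_cond. Qed.

End MainTheorem.

(** * Words and their values in the interval from [alpha] to [beta] *)

Section Itineraries.
Context {R : realType} {m : nat}.
Local Notation C := (cplx R).
Local Notation nc := (@Normc.normc R).
Implicit Types (x y : R) (w v : nat -> 'I_m.+1).

Context {h : 'I_m.+1 -> {poly R[i]}} {a b r : R}.
Context (Hesc : escape_constants h a b r).
Local Notation g w n := (word_comp h w n).

Definition itinerary w x := forall n, alpha h <= Psi (g w n) x <= beta h.

Lemma Psi_X x : Psi ('X : {poly R[i]}) x = x.
Proof. by rewrite /Psi /deg size_polyX lead_coefX modulus1 ln1 mul1r addr0. Qed.

Lemma Psi_continuous (p : {poly R[i]}) : continuous (Psi p).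
Proof.
move=> x; apply: (@continuousD _ R^o R^o (fun x => (deg p)%:R * x) (cst _)); last exact: cst_continuous.
exact: mulrl_continuous.
Qed.

Lemma Psi_word_comp_shift w n x :
  Psi (g w n.+1) x = Psi (g (word_shift w 1) n) (Psi (h (w 0%N)) x).
Proof.
elim: n => [|n IH]; first by rewrite (Psi_word_compS Hesc) /= !Psi_X.
by rewrite (Psi_word_compS Hesc) IH (Psi_word_compS Hesc).
Qed.

Lemma alpha_le_beta : alpha h <= beta h.
Proof. exact: le_trans (alpha_le_fixpoint h ord0) (fixpoint_le_beta h ord0). Qed.

(* The inverse of [Psi (h j)] is a contraction whose fixed point lies in the
   interval, so it maps the interval into itself. *)
Lemma Psi_preimage_itv j y : alpha h <= y <= beta h ->
  exists2 x, alpha h <= x <= beta h & Psi (h j) x = y.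
Proof.
move=> /andP[ay yb]; have d2 := escape_deg Hesc j.
pose d : R := (deg (h j))%:R; have {}d2 : 2 <= d by rewrite ler_nat.
have d0 : 0 < d by exact: lt_le_trans d2.
have d1 : d - 1 != 0 by rewrite gt_eqF // subr_gt0 (lt_le_trans _ d2) // ltr1n.
have := alpha_le_fixpoint h j; have := fixpoint_le_beta h j.
rewrite /Psi_fixpoint /Psi -/d; set l := ln _; set f := _ * l => fb af.
have lE : l = - (d - 1) * f by rewrite /f; field.
exists ((y + (d - 1) * f) / d); last by rewrite lE; field; rewrite gt_eqF.
have d1' : 0 <= d - 1 by move: d2 => ?; lra.
have := ler_wpM2l d1' fb; have := ler_wpM2l d1' af => h1 h2.
by rewrite ler_pdivlMr // ler_pdivrMr //; apply/andP; split; move: h1 h2 ay yb => ? ? ? ?; lra.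
Qed.

(** Built from the far end: a value for the shifted word is pulled back through the first letter,
    which keeps it in the interval. *)
Lemma itinerary_prefix w n : exists2 x, alpha h <= x <= beta h &
  forall k, (k <= n)%N -> alpha h <= Psi (g w k) x <= beta h.
Proof.
elim: n w => [|n IH] w.
  by exists (alpha h) => [|[|//] _]; rewrite ?Psi_X lexx alpha_le_beta.
have [y yab Hy] := IH (word_shift w 1).
have [x xab xy] := Psi_preimage_itv (w 0%N) yab.
exists x => // -[|k] kn; first by rewrite /= Psi_X.
by rewrite Psi_word_comp_shift xy; exact: Hy.
Qed.

(** The approximants may depend on [n] as well as on [e], which covers both truncations of one word
    and words converging to [w]. *)
Lemma itinerary_limit w x :
  (forall (e : R) n, 0 < e -> exists2 y, `|x - y| < e & alpha h <= Psi (g w n) y <= beta h) ->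
  itinerary w x.
Proof.
move=> H n; have cl : closed [set x | Psi (g w n) x \in `[alpha h, beta h]].
  rewrite (_ : [set x | _] = Psi (g w n) @^-1` `[alpha h, beta h]) //.
  by apply: closed_comp; [move=> ? _; exact: Psi_continuous|exact: itv_closed].
suff : [set x | Psi (g w n) x \in `[alpha h, beta h]] x by rewrite /= in_itv.
apply: cl => A /nbhs_ballP [e e0 He]; have [y yx yn] := H e n e0.
by exists y; split; [rewrite /= in_itv|apply: He; rewrite -ball_normE].
Qed.

Lemma exists_itinerary_point w : exists x, itinerary w x.
Proof.
have [f Hf] := choice (fun n => let: ex_intro2 x h1 h2 := itinerary_prefix w n in
  ex_intro (fun x => alpha h <= x <= beta h /\ forall k, (k <= n)%N -> _) x (conj h1 h2)).
have [|x [_ clx]] := @segment_compact R (alpha h) (beta h) (f @ \oo) _.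
  by exists 0%N => // n _ /=; rewrite in_itv; case: (Hf n).
exists x; apply: itinerary_limit => e n e0.
have [|y [[k /= nk <-] By]] := clx [set f k | k in [set k | (n <= k)%N]] (ball x e) _ (nbhsx_ballx x e e0).
  by exists n => // k nk; exists k.
by exists (f k); [rewrite -ball_normE in By|case: (Hf k) => _; exact].
Qed.

Lemma itinerary_in_itv w x : itinerary w x -> alpha h <= x <= beta h.
Proof. by move=> /(_ 0%N); rewrite /= Psi_X. Qed.

(** The word codes the orbit of [x]: at each stage the covering supplies a generator whose map keeps
    the current point in the interval. *)
Lemma itinerary_of_point x :
  `[alpha h, beta h] `<=` \bigcup_(j : 'I_m.+1) (Psi (h j) @^-1` `[alpha h, beta h]) ->
  alpha h <= x <= beta h -> exists w, itinerary w x.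
Proof.
move=> cover xab; have H y : exists j, alpha h <= y <= beta h -> alpha h <= Psi (h j) y <= beta h.
  have [yab|nyab] := boolP (alpha h <= y <= beta h); last by exists ord0.
  by have [|j _] := cover y; rewrite /= in_itv //= => Hj; exists j.
have [f Hf] := choice H.
pose orb := fix orb n := if n is n'.+1 then Psi (h (f (orb n'))) (orb n') else x.
exists (fun n => f (orb n)); suff E n : Psi (g (fun n => f (orb n)) n) x = orb n.
  by elim=> [|n IH]; rewrite E //=; apply: Hf; rewrite -E.
by elim: n => [|n IH]; [rewrite /= Psi_X|rewrite (Psi_word_compS Hesc) IH].
Qed.

Local Notation J := (@fiber_julia R m h r).

Definition itinerary_values (U : set C) : set R :=
  [set x | exists2 w, J w `&` U !=set0 & itinerary w x].

(** The words of a convergent sequence of values have a cluster word. It has the limit as its value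
    by [itinerary_limit], and its fiber meets [U] by semicontinuity. *)
Lemma itinerary_values_closed (U V : set C) z0 :
  (forall w, @filled_julia R m h r w z0) ->
  open U -> open V -> U `&` V = set0 -> (forall u, J u `<=` U `|` V) ->
  closed (itinerary_values U).
Proof.
move=> K0 oU oV UV JUV x clx.
have H n : exists yw : R * (nat -> 'I_m.+1), [/\ `|x - yw.1| < n.+1%:R^-1,
    J yw.2 `&` U !=set0 & itinerary yw.2 yw.1].
  have n0 : 0 < n.+1%:R^-1 :> R by rewrite invr_gt0.
  have [y [[w Jw Iw] xy]] := clx _ (nbhsx_ballx x _ n0).
  by exists (y, w); split=> //; rewrite -ball_normE in xy.
have [f Hf] := choice H.
have [w Hw] := word_cluster (fun n => (f n).2).
exists w.
  apply: (fiber_julia_semicontinuous Hesc K0 oU oV UV JUV) => N.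
  have [n _ nN] := Hw N 0%N; exists (f n).2 => //.
  by have [_ H2 _] := Hf n.
apply: itinerary_limit => e n e0.
have [k nk kn] := Hw n (Num.bound e^-1).
have [xk _ Ik] := Hf k; exists (f k).1; last first.
  by rewrite -(eq_word_comp h kn).
apply: (lt_le_trans xk); rewrite -[leRHS]invrK lef_pV2 ?posrE ?invr_gt0 //.
apply: ltW; apply: (lt_le_trans (archi_boundP _)); first by rewrite invr_ge0 ltW.
by rewrite ler_nat leqW.
Qed.

End Itineraries.

Theorem theorem2p14 (R : realType) (m : nat) (h : 'I_m.+1 -> {poly R[i]}) :
  postcritically_bounded (generated (range h)) ->
  `[alpha h, beta h] `<=`
    \bigcup_(j : 'I_m.+1) (Psi (h j) @^-1` `[alpha h, beta h]) ->
  connected (julia_set (generated (range h))).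
Proof.
move=> Hpcb cover.
(* The summand 1 makes [beta h < ln r] strict. *)
have [a [b [r [Hesc rbeta]]]] := exists_escape_constants (expR (beta h) + 1) Hpcb.
have r0 : 0 < r := lt_le_trans ltr01 (escape_r1 Hesc).
have ber : beta h < ln r.
  by rewrite -(expRK (beta h)) ltr_ln ?posrE ?expR_gt0 //; move: rbeta => ?; lra.
have [z0 K0] := exists_common_point Hesc.
pose J := @fiber_julia R m h r; pose values := @itinerary_values R m h r.
set Jul := julia_set _; pose J0 : set (cplx R) := [set z | Jul (finite_pt z)].
(* Infinity is a Fatou point, so the Julia set is the image of a closed set in the plane, whose
   connectedness suffices. *)
have JulE : Jul = Some @` J0.
  apply/seteqP; split=> [[z|] Jz|_ [z Jz <-] //]; first by exists z.
  by case: (Jz (fatou_infty Hesc)).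
have open_fatou : open (fatou_set (generated (range h))).
  rewrite openE => x [U [oU Ux nF]]; rewrite /interior nbhsE; exists U => //.
  by move=> y Uy; exists U.
have cJ0 : closed J0.
  have cJul : closed Jul by exact: open_closedC.
  apply: (@closed_comp (cplx R) (sphere R) Some _ _ cJul).
  by move=> z _; exact: one_point_compactification_some_continuous.
rewrite JulE; apply: connected_continuous_connected; last first.
  exact/continuous_subspaceT/one_point_compactification_some_continuous.
apply: contrapT => /(closed_disconnect cJ0) [A [B [cA cB A0 B0 [J0E AB]]]].
have [U [V [oU oV AU BV UV]]] := closed_separation cA cB AB.
have JUV w : J w `<=` U `|` V.
  move=> z /(fiber_julia_sub_julia Hesc) Jz; have : J0 z by [].
  by rewrite J0E => -[/AU|/BV]; [left|right].
have VU : V `&` U = set0 by rewrite setIC.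
have JVU w : J w `<=` V `|` U by rewrite setUC.
(* If no fiber met [W], a disc about [z] would miss all fibers and [z] would be a Fatou point. *)
have meets (W : set (cplx R)) z : open W -> J0 z -> W z ->
    exists w, J w `&` W !=set0.
  move=> oW Jz Wz; apply: contrapT => nH; apply: Jz.
  have /nbhs_modulusP[d d0 Hd] := open_nbhs_nbhs (conj oW Wz).
  have d2 : 0 < d / 2 by rewrite divr_gt0.
  apply: (fatou_off_fibers Hesc d2) => w; rewrite -subset0 => x [xz Jx].
  apply: nH; exists w, x; split=> //; apply: Hd; move: xz d0 => /= ? ?; lra.
have value (W : set (cplx R)) : open W -> J0 `&` W !=set0 ->
    values W !=set0.
  move=> oW [z [Jz Wz]]; have [w Jw] := meets W z oW Jz Wz.
  by have [x Hx] := exists_itinerary_point Hesc w; exists x, w.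
have [x [w1 J1 I1]] : values U !=set0.
  by apply: value => //; case: A0 => z Az; exists z; split; [rewrite J0E; left|exact: AU].
have [y [w2 J2 I2]] : values V !=set0.
  by apply: value => //; case: B0 => z Bz; exists z; split; [rewrite J0E; right|exact: BV].
have disj : values U `&` values V = set0.
  rewrite -subset0 => t [[w Jw Iw] [v Jv Iv]].
  exact: (fiber_julia_not_separated Hesc ber Iw Iv (K0 w) (K0 v) oU oV UV JUV Jw Jv).
have cov : `[alpha h, beta h] `<=` values U `|` values V.
  move=> t; rewrite /= in_itv /= => /(itinerary_of_point Hesc cover) [w Iw].
  have [z Jz] := fiber_julia_nonempty Hesc (K0 w).
  by have [Uz|Vz] := JUV w z Jz; [left|right]; exists w => //; exists z.
have [H|H] := connected_disjoint_closed
    (itinerary_values_closed Hesc K0 oU oV UV JUV)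
    (itinerary_values_closed Hesc K0 oV oU VU JVU) disj cov (@segment_connected R _ _).
- have Uy : values U y.
    by apply: H; rewrite /= in_itv /=; exact: (itinerary_in_itv I2).
  have : (values U `&` values V) y.
    by split=> //; exists w2.
  by rewrite disj.
- have Vx : values V x.
    by apply: H; rewrite /= in_itv /=; exact: (itinerary_in_itv I1).
  have : (values U `&` values V) x.
    by split=> //; exists w1.
  by rewrite disj.
Qed.
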